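(* Let $p$ and $p'$ be coprime integers with $0<p<p'$, $p'\ge3$, and let $r_0$ and $s_0$ be the smallest non-negative integers such that $|ps_0-p'r_0|=1$. If $p'/p$ has continued fraction $(e_0,e_1,\dots,e_{n-1},e_n+2)$, then for even $L\ge0$: $$\chi^{p,p'}_{s_0,s_0,s_0+1}(L)=\sum q^{\sum_{\mu=0}^n\sum_{i=1}^{e_\mu}\left(\lambda^{(\mu)}_i\right)^2}\prod_{\mu=0}^n\ \prod_{i=1+\delta_{\mu,0}}^{e_\mu}\begin{bmatrix}2\left(w_\mu-\sum_{j=1}^i\lambda^{(\mu)}_j\right)+\lambda^{(\mu)}_{i-1}+\lambda^{(\mu)}_i\\ \lambda^{(\mu)}_{i-1}-\lambda^{(\mu)}_i\end{bmatrix}_q,$$ where the sum is over all sequences $\lambda^{(0)},\lambda^{(1)},\dots,\lambda^{(n)}$ of partitions such that, for $0\le\mu\le n$, the partition $\lambda^{(\mu)}=(\lambda^{(\mu)}_1,\dots,\lambda^{(\mu)}_{e_\mu})$ satisfies $\lambda^{(\mu)}_1\le\lambda^{(\mu)}_0$ (for $\mu>0$) and $wt(\lambda^{(\mu)})\le w_\mu$, where $w_0=L/2$, $w_\mu=\lambda^{(\mu-1)}_{e_{\mu-1}}$ for $1\le\mu\le n$, and $\lambda^{(\mu)}_0=w_{\mu-1}-wt(\lambda^{(\mu-1)})$ for $1\le\mu\le n$; and which additionally satisfy $wt(\lambda^{(n)})=w_n$.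
   Context: Continued fraction: $p'/p$ has continued fraction $(c_0,\dots,c_n)$ if $p'/p=c_0+1/(c_1+1/(\cdots+1/c_n))$ with $c_0\ge0$, $c_i\ge1$ for $0<i<n$, $c_n\ge2$. Thus $e_\mu=c_\mu$ for $\mu<n$ and $e_n=c_n-2\ge0$. Here a partition $(\lambda_1,\dots,\lambda_e)$ is a weakly decreasing sequence of non-negative integers (zero parts allowed; empty if $e=0$) and $wt(\lambda)=\sum_i\lambda_i$ (so $wt(\lambda)=0$ if $e=0$); $\delta$ is the Kronecker delta. Gaussian polynomial: $\begin{bmatrix}A\\ B\end{bmatrix}_q=\frac{\prod_{i=1}^A(1-q^i)}{\prod_{i=1}^B(1-q^i)\prod_{i=1}^{A-B}(1-q^i)}$ for $0\le B\le A$, and $0$ otherwise. Generating function. For integers $1\le a,b,c\le p'-1$, $c=b\pm1$, $L\ge0$, $L+a-b$ even, $\mathcal P^{p,p'}_{a,b,c}(L)$ is the set of integer sequences $h=(h_0,\dots,h_L)$ with $1\le h_i\le p'-1$, $|h_{i+1}-h_i|=1$, $h_0=a$, $h_L=b$; put $h_{L+1}=c$. The band between heights $k$ and $k+1$ ($1\le k\le p'-2$) is even if $\lfloor kp/p'\rfloor=\lfloor (k+1)p/p'\rfloor$ and odd otherwise. For $1\le i\le L$ the vertex $v_i$ (segments $h_{i-1}\to h_i\to h_{i+1}$) has the parity of the band between $h_i$ and $h_{i+1}$; it is straight if $h_{i-1}\ne h_{i+1}$ and a peak otherwise. It is scoring if it is straight and odd, or a peak and even; otherwise non-scoring. With $x_i=\frac{i-(h_i-a)}2$,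 $y_i=\frac{i+(h_i-a)}2$, set $c_i=x_i$ if $v_i$ is scoring and $h_i=h_{i-1}+1$, $c_i=y_i$ if $v_i$ is scoring and $h_i=h_{i-1}-1$, $c_i=0$ if $v_i$ is non-scoring, and $wt(h)=\sum_{i=1}^Lc_i$. Then $\chi^{p,p'}_{a,b,c}(L)=\sum_{h\in\mathcal P^{p,p'}_{a,b,c}(L)}q^{wt(h)}$. (With $r=\lfloor pc/p'\rfloor+(b-c+1)/2$, this also equals $\sum_{\lambda\in\mathbb Z}q^{\lambda^2pp'+\lambda(p'r-pa)}\begin{bmatrix}L\\ \frac{L+a-b}2-p'\lambda\end{bmatrix}_q-\sum_{\lambda\in\mathbb Z}q^{(\lambda p+r)(\lambda p'+a)}\begin{bmatrix}L\\ \frac{L+a-b}2-p'\lambda-a\end{bmatrix}_q$.) *)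

(* Defs.v *)
From mathcomp Require Import all_boot all_order all_algebra.

Set Implicit Arguments.
Unset Strict Implicit.
Unset Printing Implicit Defensive.

Import Order.TTheory GRing.Theory Num.Theory.

Fixpoint cfrac_val (c : seq nat) : rat :=
  match c with
  | [::] => 0%R
  | [:: c0] => (c0%:R)%R
  | c0 :: c' => (c0%:R + (cfrac_val c')^-1)%R
  end.

(* The condition c_0 >= 0 is built into the type nat. *)
Definition has_cfrac (x : rat) (c : seq nat) : Prop :=
  [/\ c != [::],
      forall i, 0 < i < (size c).-1 -> 1 <= nth 0 c i,
      2 <= last 0 c
    & x = cfrac_val c].

(* Equalities between polynomials in q and products of Gaussian polynomials
   are stated in the field Q(q), built as the fraction field of Z[q]. *)
Definition qfield := {fraction {poly int}}.

Definition q_ : qfield := tofrac ('X : {poly int})%R.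

Definition qpoch (m : nat) : qfield := (\prod_(1 <= i < m.+1) (1 - q_ ^+ i))%R.

Definition gauss (A B : nat) : qfield :=
  (if (B <= A)%N then qpoch A / (qpoch B * qpoch (A - B)) else 0)%R.

Section Chi.

Variables (p p' a b c L : nat).

Definition odd_band (k : nat) : bool := (k * p) %/ p' != (k.+1 * p) %/ p'.

Definition is_path (h : seq nat) : bool :=
  [&& size h == L.+1,
      all (fun x => 1 <= x <= p'.-1) h,
      all (fun i => (nth 0 h i.+1 == (nth 0 h i).+1) ||
                    (nth 0 h i == (nth 0 h i.+1).+1)) (iota 0 L),
      nth 0 h 0 == a
    & nth 0 h L == b].

Section Vertex.

(* H = (h_0, ..., h_L, h_{L+1}), with h_{L+1} = c already appended. *)
Variables (H : seq nat) (i : nat).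

Definition vertex_odd : bool :=
  odd_band (minn (nth 0 H i) (nth 0 H i.+1)).

Definition straight : bool := nth 0 H i.-1 != nth 0 H i.+1.

Definition scoring : bool :=
  (straight && vertex_odd) || (~~ straight && ~~ vertex_odd).

(* On a path both differences are even natural numbers: x_i and y_i are
   the numbers of down and up steps among the first i, so neither the truncated
   subtraction nor the halving loses anything. *)
Definition xcoord : nat := (i + a - nth 0 H i)./2.

Definition ycoord : nat := (i + nth 0 H i - a)./2.

Definition vertex_wt : nat :=
  if scoring then
    if nth 0 H i == (nth 0 H i.-1).+1 then xcoord else ycoord
  else 0.

End Vertex.

Definition path_wt (h : seq nat) : nat :=
  \sum_(1 <= i < L.+1) vertex_wt (rcons h c) i.

(* Heights are at most p' - 1, so 'I_p' is large enough to hold them. *)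
Definition chi : {poly int} :=
  (\sum_(h : L.+1.-tuple 'I_p' | is_path (map val h))
     'X^(path_wt (map val h)))%R.

End Chi.

(* A sequence of partitions lambda^(0), ..., lambda^(n) is a value
   lam : seq (seq nat) with lambda^(mu) = nth [::] lam mu, stored with its
   zero parts so that it has length exactly e mu. *)
Section Families.

Variables (n : nat) (e : nat -> nat) (L : nat).

Section Family.

Variable lam : seq (seq nat).

Definition partition_at (mu : nat) : seq nat := nth [::] lam mu.

Definition partition_wt (mu : nat) : nat := sumn (partition_at mu).

(* Parts are numbered from 1. *)
Definition part (mu i : nat) : nat := nth 0 (partition_at mu) i.-1.

(* w_mu; in a continued fraction of a rational number greater than 1 the
   numbers e 0, ..., e (n - 1) are positive, so the last part exists. *)
Definition w_ (mu : nat) : nat :=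
  if mu is m.+1 then part m (e m) else L./2.

(* The part number 0 of lambda^(mu); the value at mu = 0 is never used. *)
Definition part0 (mu : nat) : nat :=
  if mu is m.+1 then w_ m - partition_wt m else 0.

Definition part_ext (mu i : nat) : nat :=
  if i is 0 then part0 mu else part mu i.

(* When e mu = 0 the condition on the first part is vacuous, part mu 1 being
   the default value 0. *)
Definition admissible : bool :=
  [&& shape lam == mkseq e n.+1,
      all (fun mu => [&& sorted geq (partition_at mu),
                         (0 < mu) ==> (part mu 1 <= part0 mu)
                       & partition_wt mu <= w_ mu]) (iota 0 n.+1)
    & partition_wt n == w_ n].

(* For admissible lam the natural number subtractions are not truncated. *)
Definition family_top (mu i : nat) : nat :=
  2 * (w_ mu - \sum_(1 <= j < i.+1) part mu j)
  + part_ext mu i.-1 + part_ext mu i.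

Definition family_bot (mu i : nat) : nat := part_ext mu i.-1 - part_ext mu i.

Definition family_exponent : nat :=
  \sum_(0 <= mu < n.+1) \sum_(1 <= i < (e mu).+1) part mu i ^ 2.

Definition family_term : qfield :=
  (q_ ^+ family_exponent *
   \prod_(0 <= mu < n.+1) \prod_(1 + (mu == 0)%N <= i < (e mu).+1)
      gauss (family_top mu i) (family_bot mu i))%R.

End Family.

(* All parts of an admissible family are at most L / 2, so the admissible
   families can be listed; mem_families and families_uniq show that the list
   is complete and free of repetitions. *)
Definition families : seq (seq (seq nat)) :=
  [seq lam <- [seq reshape (mkseq e n.+1) (map val t)
                 | t : (sumn (mkseq e n.+1)).-tuple 'I_(L./2).+1]
     | admissible lam].

Lemma leq_nth_sumn (s : seq nat) (i : nat) : nth 0 s i <= sumn s.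
Proof.
elim: s i => [|x s IHs] [|i] //=; first exact: leq_addr.
exact: leq_trans (IHs i) (leq_addl _ _).
Qed.

Lemma admissible_wt_le (lam : seq (seq nat)) (mu : nat) :
  admissible lam -> mu <= n -> partition_wt lam mu <= L./2.
Proof.
case/and3P=> _ /allP lamP _.
have wt_le m : m <= n -> partition_wt lam m <= w_ lam m.
  move=> le_mn; have := lamP m; rewrite mem_iota add0n ltnS le_mn.
  by move=> /(_ isT) /and3P[].
elim: mu => [|mu IHmu] lt_mu_n; first exact: wt_le.
apply: leq_trans (wt_le _ lt_mu_n) _ => /=.
exact: leq_trans (leq_nth_sumn _ _) (IHmu (ltnW lt_mu_n)).
Qed.

Lemma mem_families (lam : seq (seq nat)) :
  (lam \in families) = admissible lam.
Proof.
rewrite mem_filter; case: (boolP (admissible lam)) => //= adm.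
have /eqP sh_lam : shape lam == mkseq e n.+1 by case/and3P: adm.
have le_flat x : x \in flatten lam -> x < (L./2).+1.
  case/flattenP=> s s_lam x_s; rewrite ltnS.
  have sz_lam : size lam = n.+1.
    by rewrite -(size_map size) -/(shape lam) sh_lam size_mkseq.
  have lt_s : index s lam < n.+1 by rewrite -sz_lam index_mem.
  have := admissible_wt_le adm lt_s.
  rewrite /partition_wt /partition_at nth_index //; apply: leq_trans.
  by rewrite -(nth_index 0 x_s); apply: leq_nth_sumn.
have sz_t : size [seq (inord x : 'I_(L./2).+1) | x <- flatten lam]
            == sumn (mkseq e n.+1).
  by rewrite size_map size_flatten sh_lam.
apply/imageP; exists (Tuple sz_t) => //.
suff eq_flat : map val (map (fun x => inord x : 'I_(L./2).+1) (flatten lam))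
                = flatten lam by rewrite -[LHS]flattenK sh_lam -[in LHS]eq_flat.
rewrite -map_comp -[RHS]map_id; apply/eq_in_map => x /le_flat lt_x /=.
by rewrite inordK.
Qed.

Lemma families_uniq : uniq families.
Proof.
apply/filter_uniq/dinjectiveP => t u _ _ eq_tu.
apply/val_inj/(inj_map val_inj).
by rewrite -[LHS](@reshapeKr _ (mkseq e n.+1)) ?eq_tu ?reshapeKr //
   size_map size_tuple.
Qed.

End Families.

(* Main.v *)
Require Import Defs.
From mathcomp Require Import all_boot all_order all_algebra.
From mathcomp Require Import zify ring.

(** Adding the last segment of a path satisfies the two q-Pascal rules termwise
in the alternating sum over [l], so the path generating function equals its
bosonic form.  The pair sums

  [Y(p,p',r,s;L,M) = sum_l q^(l^2 p p' + l(p' r - p s)) B(L,M,p l,p' l)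
                     - q^((l p + r)(l p' + s)) B(L,M,l p + r,l p' + s)],

where [B(L,M,a,b)] is a product of two Gaussian polynomials, refine it by a
second size parameter [M].  The q-Saalschuetz summation gives the Burge transform

  [sum_i q^(i^2) [2L+M-i; 2L] B(L-i,i,a,b) = q^(a^2) B(L,M,a,a+b)],

which takes [Y(p,p',r,s)] to [Y(p,p'+p,r,s+r)], while the symmetry
[B(L,M,a,b) = B(M,L,b,a)] exchanges [p] with [p'] and [L] with [M].  Unwinding
the continued fraction of [p'/p] with these two moves reaches [Y(1,2)], which is
the Kronecker delta of [L = 0]; the summation indices of the successive Burge
transforms are the parts of the partitions, and the exchange of [L] and [M] is
the passage from one partition to the next. *)
Set Implicit Arguments.
Unset Strict Implicit.
Unset Printing Implicit Defensive.

Import Order.TTheory GRing.Theory Num.Theory.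

(** * Paths built by appending the last height *)

Section Paths.

Variables (p p' a : nat).

(** The recursion is on the last step because the last vertex weight depends only on the last two
    heights and [c]. Heights outside the strip give the empty list, which encodes the two walls. *)
Fixpoint paths (L b : nat) : seq (seq nat) :=
  if 0 < b < p' then
    if L is L'.+1 then [seq rcons s b | s <- paths L' b.-1 ++ paths L' b.+1]
    else if b == a then [:: [:: a]] else [::]
  else [::].

Lemma pathsS (L b : nat) :
  paths L.+1 b = if 0 < b < p'
    then [seq rcons s b | s <- paths L b.-1 ++ paths L b.+1] else [::].
Proof. by []. Qed.

Lemma is_path_rcons (L b x : nat) (s : seq nat) :
  is_path p' a b L.+1 (rcons s x) =
  [&& x == b, 0 < b < p' & is_path p' a b.-1 L s || is_path p' a b.+1 L s].
Proof.
rewrite /is_path size_rcons eqSS all_rcons.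
have [sz_s|] := eqVneq (size s) L.+1; last by rewrite !andbF.
have nth_s i : i <= L -> nth 0 (rcons s x) i = nth 0 s i.
  by move=> le_iL; rewrite nth_rcons sz_s ltnS le_iL.
have nth_x : nth 0 (rcons s x) L.+1 = x by rewrite nth_rcons sz_s ltnn eqxx.
rewrite -[L.+1]addn1 iotaD all_cat /= add0n andbT addn1 nth_x !nth_s //.
have -> : all (fun i => (nth 0 (rcons s x) i.+1 == (nth 0 (rcons s x) i).+1)
       || (nth 0 (rcons s x) i == (nth 0 (rcons s x) i.+1).+1)) (iota 0 L)
  = all (fun i => (nth 0 s i.+1 == (nth 0 s i).+1)
       || (nth 0 s i == (nth 0 s i.+1).+1)) (iota 0 L).
  apply: eq_in_all => i; rewrite mem_iota => /andP[_ lt_iL].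
  by rewrite !nth_s // ltnW.
set A := all _ (iota 0 L); set B := all _ s; set C := nth 0 s 0 == a.
have [->|neq_xb] := eqVneq x b; last by rewrite !andbF.
have -> : (0 < b <= p'.-1) = (0 < b < p') by lia.
case: A B C => [] [] [] //=; rewrite ?andbT ?andbF //.
case: (boolP (0 < b < p')) => //= lt_b; lia.
Qed.

Lemma mem_paths (L b : nat) (s : seq nat) :
  (s \in paths L b) = is_path p' a b L s.
Proof.
elim: L b s => [|L IHL] b s.
  rewrite /is_path /=; case: s => [|x [|y s]] /=.
  - by do 2?case: ifP.
  - rewrite andbT; case: ifP => lt_b; last by rewrite in_nil; lia.
    case: (eqVneq b a) lt_b => [->|neq_ba] lt_b; rewrite ?in_nil ?inE ?eqseq_cons ?eqxx ?andbT; lia.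
  - case: ifP => // _; case: ifP => // _.
    by rewrite inE eqseq_cons andbF.
rewrite pathsS; case/lastP: s => [|s x].
  rewrite [RHS]/is_path /=; case: ifP => // _.
  by apply/negP=> /mapP[[|y t]].
rewrite is_path_rcons; case: ifP => lt_b; last by rewrite andbF.
rewrite andTb; apply/mapP/andP => [[t t_in /rcons_inj[-> ->]]|[/eqP-> s_in]].
  by rewrite eqxx -!IHL -mem_cat.
by exists s => //; rewrite mem_cat !IHL.
Qed.

Lemma paths_uniq (L b : nat) : uniq (paths L b).
Proof.
elim: L b => [|L IHL] b; first by rewrite /=; do 2?case: ifP.
rewrite pathsS; case: ifP => // lt_b.
rewrite map_inj_uniq; last by move=> s t /rcons_inj[].
rewrite cat_uniq !IHL andbT /=; apply/hasPn => s /=; rewrite !mem_paths.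
move=> /and5P[_ _ _ _ /eqP eq1]; apply/negP => /and5P[_ _ _ _ /eqP eq2].
lia.
Qed.

(** Discards the cases where the truncated halves in [turn_wt] differ from the integer exponents of
    the bosonic recursion. *)
Lemma paths_unreachable (L b : nat) : (a + L < b) || (b + L < a) -> paths L b = [::].
Proof.
elim: L b => [|L IHL] b far.
  by rewrite /=; case: ifP => // _; rewrite ifF //; apply/eqP; lia.
rewrite pathsS; case: ifP => // lt_b.
by rewrite !IHL //; lia.
Qed.

(** Weight of a vertex at height [b] between [h] and [c]. The single comparison of [h != c] with the
    band parity covers both scoring cases. *)
Definition turn_wt (i h b c : nat) : nat :=
  if (h != c) == odd_band p p' (minn b c)
  then if b == h.+1 then (i + a - b)./2 else (i + b - a)./2
  else 0.

(** Earlier vertices do not see [c]: for the shortened path, [b] itself takes the place of the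
    appended height. *)
Lemma path_wt_rcons (L b c h : nat) (s : seq nat) :
  is_path p' a h L s ->
  path_wt p p' a c L.+1 (rcons s b) = path_wt p p' a b L s + turn_wt L.+1 h b c.
Proof.
case/and5P => /eqP sz_s _ _ _ /eqP nth_L.
rewrite /path_wt big_nat_recr //=; congr (_ + _).
  apply: eq_big_nat => i /andP[i_gt0 lt_iL].
  have E j : j <= L.+1 -> nth 0 (rcons (rcons s b) c) j = nth 0 (rcons s b) j.
    by move=> le_j; rewrite nth_rcons size_rcons sz_s ltnS le_j.
  by rewrite /vertex_wt /scoring /straight /vertex_odd /xcoord /ycoord !E //; lia.
have E1 : nth 0 (rcons (rcons s b) c) L = h.
  by rewrite !nth_rcons size_rcons sz_s !ltnS leqnSn leqnn.
have E2 : nth 0 (rcons (rcons s b) c) L.+1 = b.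
  by rewrite !nth_rcons size_rcons sz_s !ltnS leqnn ltnn eqxx.
have E3 : nth 0 (rcons (rcons s b) c) L.+2 = c.
  by rewrite nth_rcons size_rcons sz_s ltnn eqxx.
rewrite /vertex_wt /scoring /straight /vertex_odd /xcoord /ycoord /= E1 E2 E3.
by rewrite /turn_wt; case: (h != c); case: (odd_band _ _ _).
Qed.

End Paths.

(** * Admissible families, enumerated level by level *)

(** The bounds handed on, [L - i] and [i], are the arguments at which a Burge transform evaluates
    its function. *)
Fixpoint part_list (k L M : nat) : seq (seq nat) :=
  if k is k'.+1
  then [seq i :: s | i <- [seq i <- iota 0 M.+1 | i <= L], s <- part_list k' (L - i) i]
  else [:: [::]].

(* After a level [s], the next one starts with the roles of [L - sumn s] and of
   the last part exchanged; the condition [wt(lambda^(n)) = w_n] thus reads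
   [M = 0] when no level is left. *)
Fixpoint family_list (es : seq nat) (L M : nat) : seq (seq (seq nat)) :=
  if es is e :: es'
  then [seq s :: f | s <- part_list e L M, f <- family_list es' (last M s) (L - sumn s)]
  else if M == 0 then [:: [::]] else [::].

Lemma part_listS (k L M : nat) :
  part_list k.+1 L M
  = [seq i :: s | i <- [seq i <- iota 0 M.+1 | i <= L], s <- part_list k (L - i) i].
Proof. by []. Qed.

Lemma family_listS (e L M : nat) (es : seq nat) :
  family_list (e :: es) L M
  = [seq s :: f | s <- part_list e L M, f <- family_list es (last M s) (L - sumn s)].
Proof. by []. Qed.

Lemma mem_part_list (k L M : nat) (s : seq nat) :
  (s \in part_list k L M) = [&& size s == k, path geq M s & sumn s <= L].
Proof.
elim: k L M s => [|k IHk] L M s; first by rewrite /= inE; case: s.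
apply/allpairsPdep/and3P => [[i [t [i_in t_in ->]]]|].
  move: i_in t_in; rewrite mem_filter mem_iota IHk => /and3P[le_iL _ lt_iM].
  case/and3P=> sz_t path_t le_t; rewrite /= eqSS sz_t path_t.
  by split=> //; lia.
case: s => [|i t] [] // sz_t path_it le_L.
have /andP[le_iM path_t] : (i <= M) && path geq i t := path_it.
rewrite /= eqSS in sz_t; rewrite /= in le_L.
exists i, t; rewrite mem_filter mem_iota IHk sz_t path_t; split=> //; lia.
Qed.

Lemma part_list_uniq (k L M : nat) : uniq (part_list k L M).
Proof.
elim: k L M => [|k IHk] L M; first by [].
apply: (@allpairs_uniq_dep nat (fun=> seq nat) (seq nat) (fun i s => i :: s))
  => [|i _|]; [exact/filter_uniq/iota_uniq | exact: IHk |].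
by move=> [i s] [j t] _ _ /= [-> ->].
Qed.

Lemma family_list_uniq (es : seq nat) (L M : nat) : uniq (family_list es L M).
Proof.
elim: es L M => [|e es IHes] L M /=; first by case: ifP.
apply: (@allpairs_uniq_dep (seq nat) (fun=> seq (seq nat)) (seq (seq nat))
                            (fun s f => s :: f)) => [|s _|]; [exact: part_list_uniq | exact: IHes |].
by move=> [s f] [t g] _ _ /= [-> ->].
Qed.

Lemma mem_family_list_cons (e : nat) (es : seq nat) (L M : nat) (s : seq nat)
    (f : seq (seq nat)) :
  (s :: f \in family_list (e :: es) L M)
  = (s \in part_list e L M) && (f \in family_list es (last M s) (L - sumn s)).
Proof.
apply/allpairsPdep/andP => [[t [g [t_in g_in [-> ->]]]] //|[s_in f_in]].
by exists s, f.
Qed.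

Lemma path_geqE (M : nat) (s : seq nat) :
  path geq M s = sorted geq s && (nth 0 s 0 <= M).
Proof. by case: s => //= x s; rewrite andbC. Qed.

Section Admissible.

Variables (n L : nat) (e : nat -> nat) (lam : seq (seq nat)).
Hypothesis e_gt0 : forall mu, mu < n -> 0 < e mu.
Hypothesis shape_lam : shape lam = mkseq e n.+1.

Local Notation w_ := (w_ e L lam).
Local Notation part0 := (part0 e L lam).
Local Notation wt := (partition_wt lam).

Lemma size_lam : size lam = n.+1.
Proof. by rewrite -(size_map size) -/(shape lam) shape_lam size_mkseq. Qed.

Lemma size_partition_at (mu : nat) : mu <= n -> size (partition_at lam mu) = e mu.
Proof.
move=> le_mu; rewrite /partition_at -(nth_map [::] 0) ?size_lam //.
by rewrite -/(shape lam) shape_lam nth_mkseq.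
Qed.

Lemma drop_lam (mu : nat) : mu <= n ->
  drop mu lam = partition_at lam mu :: drop mu.+1 lam.
Proof. by move=> le_mu; rewrite (drop_nth [::]) // size_lam. Qed.

Lemma w_S (mu M : nat) : mu < n -> w_ mu.+1 = last M (partition_at lam mu).
Proof.
move=> lt_mu /=; have := size_partition_at (ltnW lt_mu); have := e_gt0 lt_mu.
rewrite /part; case: (partition_at lam mu) => [|x s] /= e0 sz; first by lia.
by rewrite -sz /= -last_nth.
Qed.

Definition level_ok (mu : nat) : bool :=
  [&& sorted geq (partition_at lam mu),
      (0 < mu) ==> (part lam mu 1 <= part0 mu) & wt mu <= w_ mu].

(** At level 0 the list bounds the first part by [L./2]; this follows from [wt 0 <= w_ 0], as a part
    is at most the weight. *)
Lemma mem_part_list_level (mu : nat) : mu <= n ->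
  (partition_at lam mu \in part_list (e mu) (w_ mu) (if mu is 0 then L./2 else part0 mu))
  = level_ok mu.
Proof.
move=> le_mu; rewrite mem_part_list size_partition_at // eqxx andTb path_geqE /level_ok andbA.
case: mu le_mu => [|mu] _; last by [].
rewrite andbT; case: (boolP (wt 0 <= _)) => [le_w|]; last by rewrite !andbF.
by rewrite (leq_trans (leq_nth_sumn _ _) le_w) andbT.
Qed.

Lemma mem_family_list_from (k mu : nat) : mu + k = n ->
  (drop mu lam \in family_list (map e (iota mu k.+1)) (w_ mu)
                    (if mu is 0 then L./2 else part0 mu))
  = all level_ok (iota mu k.+1) && (wt n == w_ n).
Proof.
elim: k mu => [|k IHk] mu e_n.
  rewrite addn0 in e_n; rewrite drop_lam ?e_n // mem_family_list_cons mem_part_list_level ?e_n //.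
  rewrite -e_n drop_oversize ?size_lam ?e_n //= andbT.
  case: (boolP (level_ok n)) => //= /and3P[_ _]; rewrite /partition_wt => le_w.
  (* What is left as second argument is [w_ n - wt n]; given [wt n <= w_ n], its vanishing is the
     final equality. *)
  by rewrite subn_eq0 eqn_leq le_w /=; case: ifP.
have lt_mu : mu < n by lia.
rewrite drop_lam ?(ltnW lt_mu) // mem_family_list_cons mem_part_list_level ?(ltnW lt_mu) //.
rewrite -w_S // [iota mu k.+2]/= [all _ (_ :: _)]/= -andbA; congr (_ && _).
by rewrite -(IHk mu.+1) // addSnnS.
Qed.

End Admissible.

Lemma mem_family_list (n L : nat) (e : nat -> nat) (lam : seq (seq nat)) :
  (forall mu, mu < n -> 0 < e mu) ->
  (lam \in family_list (mkseq e n.+1) L./2 L./2) = admissible n e L lam.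
Proof.
move=> e_gt0; rewrite /admissible.
have [sh|nsh] := eqVneq (shape lam) (mkseq e n.+1).
  by have := mem_family_list_from L e_gt0 sh (add0n n); rewrite drop0 => ->.
apply/negbTE; apply: contra nsh => lam_in; apply/eqP.
(* Membership forces the shape for any two bounds, so both occurrences of [L./2] are generalised
   separately. *)
elim: (mkseq e n.+1) lam (L./2) {2}(L./2) lam_in => [|c es IHes] lam' L1 M1.
  by rewrite /=; case: ifP => // _; rewrite inE => /eqP->.
case: lam' => [|s f]; first by case/allpairsPdep => [? [? []]].
rewrite mem_family_list_cons mem_part_list => /andP[/and3P[/eqP sz_s _ _] /IHes sh_f].
by rewrite /= sz_s; congr (_ :: _).
Qed.

Local Open Scope ring_scope.

Lemma sum_tuple_seq (m n : nat) (P : pred (seq nat)) (R : nmodType)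
  (f : seq nat -> R) (r : seq (seq nat)) :
  uniq r ->
  (forall s, (s \in r) = [&& size s == n, all (fun x => x < m)%N s & P s]) ->
  \sum_(h : n.-tuple 'I_m | P (map val h)) f (map val h) = \sum_(s <- r) f s.
Proof.
move=> uniq_r mem_r.
rewrite -[LHS]big_filter -(big_map (fun h : n.-tuple 'I_m => map val h) predT f).
apply: perm_big; apply: uniq_perm => //.
  rewrite map_inj_uniq ?filter_uniq ?index_enum_uniq //.
  by move=> h h' /(inj_map val_inj)/val_inj.
move=> s; rewrite mem_r; apply/mapP/and3P => [[h]|[/eqP sz_s lt_s Ps]].
  rewrite mem_filter => /andP[Ph _] ->; split => //.
    by rewrite size_map size_tuple.
  by apply/allP => _ /mapP[x _ ->]; apply: ltn_ord.
have sE : map val (pmap insub s : seq 'I_m) = s.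
  rewrite (pmap_filter (insubK _)); apply/all_filterP/allP => x /(allP lt_s) lt_x.
  by rewrite /= insubT.
have sz_t : size (pmap insub s : seq 'I_m) == n by rewrite -sz_s -[in X in _ == X]sE size_map.
by exists (Tuple sz_t); rewrite ?mem_filter ?mem_index_enum ?andbT //= sE.
Qed.

(** * Continued fractions and the minimal solution *)

(** Needed to undo [k] Burge transforms. A negative [s - k * r] would push the determinant above 1;
    the upper bound is the lower one for [(p - r, p' - s)], whose determinant has the opposite
    sign. *)
Lemma burge_bounds (p p' r s k : int) :
  0 < p -> 0 < p' - k * p -> `|p' * r - p * s| = 1 ->
  0 <= r <= p -> 0 <= s <= p' -> 0 <= s - k * r <= p' - k * p.
Proof.
move=> p0 p'0 det /andP[r0 rp] /andP[s0 sp'].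
have lower (r1 s1 : int) : 0 <= r1 -> 0 <= s1 ->
    (p' - k * p) * r1 - p * (s1 - k * r1) <= 1 -> 0 <= s1 - k * r1.
  move=> r10 s10 le1; have [r1z|r1p] := eqVneq r1 0; first by rewrite r1z mulr0 subr0.
  have : 0 <= p * (s1 - k * r1) by nia.
  by rewrite pmulr_rge0.
apply/andP; split; first by apply: lower => //; nia.
rewrite -subr_ge0.
have -> : p' - k * p - (s - k * r) = (p' - s) - k * (p - r) by ring.
by apply: lower; [lia|lia|nia].
Qed.

Lemma cfrac_val_cons (c x : nat) (es : seq nat) :
  cfrac_val (c :: rcons es x) = c%:R + (cfrac_val (rcons es x))^-1.
Proof. by case: es. Qed.

Lemma cfrac_val_gt0 (es : seq nat) (x : nat) :
  (0 < x)%N -> 0 < cfrac_val (rcons es x).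
Proof.
move=> x0; elim: es => [|c es IHes]; first by rewrite /= ltr0n.
by rewrite rcons_cons cfrac_val_cons ltr_wpDl // invr_gt0.
Qed.

(** If [s0 >= p'], subtracting [(p, p')] would give a smaller solution. Since [p * s0.+1] is
    [p' * r0 + p] up to 1, the floor can only be in doubt when [p' = p + 1]. *)
Lemma minimal_solution (p p' r0 s0 : nat) :
  (0 < p)%N -> (p < p')%N -> (3 <= p')%N ->
  `|(p * s0)%N%:Z - (p' * r0)%N%:Z| = 1 :> int ->
  (forall r s : nat, `|(p * s)%N%:Z - (p' * r)%N%:Z| = 1 :> int ->
     (r0 <= r)%N /\ (s0 <= s)%N) ->
  [/\ (0 < s0 < p')%N, (r0 <= p)%N & (s0.+1 * p %/ p' = r0)%N].
Proof.
move=> hp hpp' hp' hrs hmin.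
have {}hrs : (p * s0 = p' * r0 + 1 \/ p * s0 + 1 = p' * r0)%N by lia.
have {}hmin r s : (p * s = p' * r + 1 \/ p * s + 1 = p' * r)%N ->
    (r0 <= r)%N /\ (s0 <= s)%N by move=> rs; apply: hmin; lia.
have s0_gt0 : (0 < s0)%N.
  rewrite lt0n; apply/eqP => s00; move: hrs; rewrite s00 muln0.
  by case: r0 {hmin} => [|r]; rewrite ?muln0 ?mulnS; lia.
have lt_s0 : (s0 < p')%N.
  rewrite ltnNge; apply/negP => le_s0.
  have le_pp : (p * p' <= p * s0)%N by rewrite leq_mul2l le_s0 orbT.
  have le_r0 : (p <= r0)%N.
    rewrite leqNgt; apply/negP => lt_r0.
    have : (p' * r0.+1 <= p' * p)%N by rewrite leq_mul2l lt_r0 orbT.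
    by rewrite mulnS [(p' * p)%N]mulnC; lia.
  have [|] := hmin (r0 - p)%N (s0 - p')%N; last by lia.
  have : (p' * p <= p' * r0)%N by rewrite leq_mul2l le_r0 orbT.
  by rewrite !mulnBr [(p' * p)%N]mulnC; lia.
have le_r0 : (r0 <= p)%N.
  rewrite leqNgt; apply/negP => lt_r0.
  have : (p' * p.+1 <= p' * r0)%N by rewrite leq_mul2l lt_r0 orbT.
  have : (p * s0.+1 <= p * p')%N by rewrite leq_mul2l lt_s0 orbT.
  by rewrite !mulnS [(p' * p)%N]mulnC; lia.
split=> //; first by rewrite s0_gt0.
suff /andP[le lt] : (p' * r0 <= p * s0 + p < p' * r0 + p')%N.
  by rewrite mulnC mulnS addnC -(subnKC le) mulnC divnMDl ?divn_small; lia.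
(* For [p' = p + 1] the pair [(1, 1)] is a solution, so minimality and [p' >= 3] give [s0 = r0 = 1],
   excluding the sign for which the remainder would be [p']. *)
have [ep'|np'] := eqVneq p' p.+1; last by lia.
have [|le1 le2] := hmin 1%N 1%N; first by lia.
have s1 : s0 = 1%N by lia.
by move: hrs; rewrite s1; case: r0 le1 {hmin le_r0} => [|[|]]; lia.
Qed.

(** For [n = 0], coprimality gives [p = 1], and [p' >= 3] makes [e 0] positive. For [n > 0], a zero
    head would make [p'/p] the inverse of a number at least 1, against [p < p']. *)
Lemma cfrac_pos_head (p p' n : nat) (e : nat -> nat) :
  (0 < p)%N -> (p < p')%N -> (3 <= p')%N -> coprime p p' ->
  has_cfrac (p'%:R / p%:R) (rcons (mkseq e n) (e n + 2)) ->
  forall mu, (mu == 0)%N || (mu < n)%N -> (0 < e mu)%N.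
Proof.
move=> hp hpp' hp' hcop [_ mid _ val].
have p_neq0 : p%:R != 0 :> rat by rewrite pnatr_eq0 -lt0n.
have {}mid mu : (0 < mu < n)%N -> (0 < e mu)%N.
  move=> /andP[mu0 ltmu]; have := mid mu.
  rewrite size_rcons size_mkseq nth_rcons size_mkseq ltmu nth_mkseq //.
  by rewrite mu0; apply.
case=> [_|mu lt_mu]; last exact: mid.
case: n val mid => [|n] val mid.
  have {}val : p'%:R / p%:R = (e 0%N + 2)%:R :> rat := val.
  have p'E : p' = ((e 0 + 2) * p)%N.
    by apply/eqP; rewrite -(eqr_nat rat) natrM -val divfK.
  move: hcop; rewrite p'E /coprime gcdnMl => /eqP p1.
  by move: hp'; rewrite p'E p1; lia.
rewrite lt0n; apply/eqP => e0.
move: val; rewrite -[mkseq _ _]/(e 0%N :: [seq e i | i <- iota 1 n]) e0.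
rewrite rcons_cons cfrac_val_cons add0r => val.
have v_ge1 : 1 <= cfrac_val (rcons [seq e i | i <- iota 1 n] (e n.+1 + 2)).
  case: n mid {val} => [|n] mid; first by rewrite /= ler1n; lia.
  rewrite -[iota 1 n.+1]/(1%N :: iota 2 n) map_cons rcons_cons.
  rewrite cfrac_val_cons -[1]addr0 lerD ?ler1n ?mid //.
  by rewrite invr_ge0 ltW ?cfrac_val_gt0 //; lia.
have : p'%:R / p%:R <= 1 :> rat by rewrite val invf_le1 // (lt_le_trans ltr01).
by rewrite ler_pdivrMr ?ltr0n // mul1r ler_nat leqNgt hpp'.
Qed.

(** The outermost transform is treated apart, so the chain starts from [p'/p - 1]. The form
    [rcons es x] covers [n = 0], where head and last quotient coincide. *)
Lemma cfrac_lower_head (n : nat) (e : nat -> nat) : (0 < e 0)%N ->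
  exists es x, rcons es x = (e 0).-1 :: [seq e i | i <- iota 1 n] /\
    cfrac_val (rcons es (x + 2)) = cfrac_val (rcons (mkseq e n) (e n + 2)) - 1.
Proof.
move=> e0; have e0E : (e 0)%:R - 1 = (e 0).-1%:R :> rat.
  by rewrite -[in LHS](prednK e0) -natr1 addrK.
case: n => [|n].
  exists [::], (e 0).-1; split=> //=.
  by rewrite !natrD -e0E addrAC.
exists ((e 0).-1 :: [seq e i | i <- iota 1 n]), (e n.+1); split.
  by rewrite rcons_cons -map_rcons -cats1 -[[:: n.+1]]/(iota n.+1 1) -iotaD addn1.
rewrite -[mkseq _ _]/(e 0%N :: [seq e i | i <- iota 1 n]).
by rewrite !rcons_cons !cfrac_val_cons -e0E addrAC.
Qed.

(** * Sums over [-N <= l <= N] *)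

Section SymmetricSums.

Variable F : fieldType.

(** Stands for a sum over all integers: [N] is chosen so large that the Gaussian polynomials vanish
    at the ends, which legitimises shifts of [l]. *)
Definition zsum (N : nat) (f : int -> F) : F :=
  \sum_(0 <= j < (2 * N).+1) f (j%:Z - N%:Z).

Lemma eq_zsum (N : nat) (f g : int -> F) : f =1 g -> zsum N f = zsum N g.
Proof. by move=> eqfg; apply: eq_bigr => j _; apply: eqfg. Qed.

Lemma zsumB (N : nat) (f g : int -> F) :
  zsum N (fun l => f l - g l) = zsum N f - zsum N g.
Proof. by rewrite /zsum sumrB. Qed.

Lemma zsumZ (N : nat) (c : F) (f : int -> F) :
  zsum N (fun l => c * f l) = c * zsum N f.
Proof. by rewrite /zsum mulr_sumr. Qed.

Lemma zsumD (N : nat) (f g : int -> F) :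
  zsum N (fun l => f l + g l) = zsum N f + zsum N g.
Proof. by rewrite /zsum big_split. Qed.

Lemma zsum_opp (N : nat) (f : int -> F) :
  zsum N f = zsum N (fun l => f (- l)).
Proof.
rewrite /zsum big_nat_rev; apply: eq_big_nat => j /andP[_ lt_j].
by congr (f _); lia.
Qed.

Lemma zsum_telescope (N : nat) (f : int -> F) :
  zsum N (fun l => f l - f (l - 1)) = f N%:Z - f (- N%:Z - 1).
Proof.
have E n : \sum_(0 <= j < n) (f (j%:Z - N%:Z) - f (j%:Z - N%:Z - 1))
           = f (n%:Z - N%:Z - 1) - f (- N%:Z - 1).
  elim: n => [|n IHn]; first by rewrite big_geq // add0r subrr.
  rewrite big_nat_recr //= IHn addrC addrA subrK.
  by congr (f _ - _); lia.
by rewrite /zsum E; congr (f _ - _); lia.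
Qed.

Lemma zsum_shift (N : nat) (f : int -> F) :
  f N%:Z = 0 -> f (- N%:Z - 1) = 0 -> zsum N (fun l => f (l - 1)) = zsum N f.
Proof.
move=> f1 f2; apply/eqP; rewrite eq_sym -subr_eq0 -zsumB zsum_telescope.
by rewrite f1 f2 subrr.
Qed.

Lemma zsum_single (N : nat) (f : int -> F) :
  (forall l, l != 0 -> f l = 0) -> zsum N f = f 0.
Proof.
move=> f0; rewrite /zsum (bigD1_seq N) ?iota_uniq ?mem_index_iota //=; last by lia.
rewrite subrr big1 ?addr0 // => j neq_jN; apply: f0; lia.
Qed.

End SymmetricSums.

(** * Iterated Burge transforms as sums over families *)

Section QSeries.

Variables (F : fieldType) (q : F).

(** Field and [q] stay abstract here; at [q_] the next two definitions become [qpoch] and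
    [gauss]. *)
Definition qp (m : nat) : F := \prod_(1 <= i < m.+1) (1 - q ^+ i).

Definition qbin (A B : nat) : F :=
  if (B <= A)%N then qp A / (qp B * qp (A - B)) else 0.

Definition burge_op (f : nat -> nat -> F) (L M : nat) : F :=
  \sum_(0 <= i < M.+1 | (i <= L)%N)
     q ^+ (i ^ 2) * qbin (2 * L + M - i) (M - i) * f (L - i)%N i.

(** Each quotient is a block of transforms followed by an exchange of the sizes. The end value tests
    [M], because after the last exchange it is the delta of [L = 0] produced by [Y(1,2)]. *)
Fixpoint burge_chain (es : seq nat) : nat -> nat -> F :=
  if es is e :: es' then iter e burge_op (fun L M => burge_chain es' M L)
  else fun _ M => (M == 0%N)%:R.

Fixpoint part_term (L M : nat) (s : seq nat) : F :=
  if s is i :: s'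
  then q ^+ (i ^ 2) * qbin (2 * L + M - i) (M - i) * part_term (L - i) i s'
  else 1.

Fixpoint fam_term (L M : nat) (f : seq (seq nat)) : F :=
  if f is s :: f' then part_term L M s * fam_term (last M s) (L - sumn s) f'
  else 1.

Lemma iter_burge_op (k L M : nat) (f : nat -> nat -> F) :
  iter k burge_op f L M
  = \sum_(s <- part_list k L M) part_term L M s * f (L - sumn s)%N (last M s).
Proof.
elim: k L M => [|k IHk] L M; first by rewrite big_seq1 /= subn0 mul1r.
rewrite iterS part_listS big_allpairs_dep big_filter -[M.+1]subn0 -/(index_iota 0 M.+1).
rewrite /burge_op; apply: eq_bigr => i _; rewrite IHk mulr_sumr.
by apply: eq_bigr => s _; rewrite /= subnDA mulrA.
Qed.

Lemma burge_chain_family_list (es : seq nat) (L M : nat) :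
  burge_chain es L M = \sum_(f <- family_list es L M) fam_term L M f.
Proof.
elim: es L M => [|e es IHes] L M /=.
  by case: ifP => _; rewrite ?big_seq1 ?big_nil.
rewrite iter_burge_op big_allpairs_dep; apply: eq_bigr => s _.
by rewrite IHes mulr_sumr.
Qed.

(* The first Gaussian polynomial is dropped: this is the product
   [prod_(i = 1 + delta_(mu,0))] of the theorem at [mu = 0]. *)
Definition top_term (w : nat) (f : seq (seq nat)) : F :=
  if f is (i :: s) :: f' then q ^+ (i ^ 2) * fam_term (w - i) i (s :: f') else 0.

(** The outer index [i] becomes the first part of the first partition, hence [e.+1] on the right. *)
Lemma top_family_list (e w : nat) (es : seq nat) :
  \sum_(0 <= i < w.+1) q ^+ (i ^ 2) * burge_chain (e :: es) (w - i) i
  = \sum_(f <- family_list (e.+1 :: es) w w) top_term w f.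
Proof.
rewrite family_listS big_allpairs_dep part_listS.
rewrite big_allpairs_dep big_filter -[w.+1]subn0 -/(index_iota 0 w.+1).
rewrite [RHS]big_nat_cond big_nat; apply: eq_big => [i|i _]; first by lia.
rewrite -/(burge_chain (e :: es) (w - i) i) burge_chain_family_list /=.
rewrite big_allpairs_dep mulr_sumr; apply: eq_bigr => s _.
by rewrite mulr_sumr /= subnDA.
Qed.

Lemma part_termE (L M : nat) (s : seq nat) : (sumn s <= L)%N ->
  part_term L M s = q ^+ (\sum_(0 <= i < size s) nth 0%N s i ^ 2) *
    \prod_(0 <= i < size s)
      qbin (2 * (L - \sum_(0 <= j < i.+1) nth 0%N s j)
          + nth 0%N (M :: s) i + nth 0%N s i)
         (nth 0%N (M :: s) i - nth 0%N s i).
Proof.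
elim: s L M => [|x s IHs] L M /= le_L; first by rewrite !big_geq // expr0 mulr1.
rewrite IHs; last by lia.
rewrite !big_nat_recl //= exprD (@big_geq _ _ _ 0 0) // addn0.
(* This turns the upper entry of the transform into the one of the theorem; it relies on
   [x <= L]. *)
have -> : (2 * L + M - x = 2 * (L - x) + M + x)%N by lia.
rewrite mulrACA; congr (_ * (_ * _)).
by apply: eq_bigr => i _; rewrite [in RHS]big_nat_recl //= subnDA.
Qed.

Lemma top_term_cons (w x : nat) (s : seq nat) (f : seq (seq nat)) :
  (x + sumn s <= w)%N ->
  top_term w ((x :: s) :: f)
  = q ^+ (\sum_(0 <= i < (size s).+1) nth 0%N (x :: s) i ^ 2) *
    \prod_(0 <= i < size s)
      qbin (2 * (w - \sum_(0 <= j < i.+2) nth 0%N (x :: s) j)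
          + nth 0%N (x :: s) i + nth 0%N s i)
         (nth 0%N (x :: s) i - nth 0%N s i) *
    fam_term (last x s) (w - (x + sumn s)) f.
Proof.
move=> le_w; rewrite /= part_termE; last by lia.
rewrite big_nat_recl //= exprD !mulrA subnDA; congr (_ * _ * _).
by apply: eq_bigr => i _; rewrite [in RHS]big_nat_recl //= subnDA.
Qed.

(** * Recursive terms matched with the indexed product of the theorem *)

Section AdmissibleTerm.

Variables (n L : nat) (e : nat -> nat) (lam : seq (seq nat)).
Hypothesis n_e_gt0 : forall mu, (mu < n)%N -> (0 < e mu)%N.
Hypothesis e0_gt0 : (0 < e 0)%N.
Hypothesis lam_adm : admissible n e L lam.

Local Notation w_ := (w_ e L lam).
Local Notation part0 := (part0 e L lam).

Let shape_lam : shape lam = mkseq e n.+1.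
Proof. by apply/eqP; case/and3P: lam_adm. Qed.

Lemma admissible_wt_le_w (mu : nat) : (mu <= n)%N ->
  (partition_wt lam mu <= w_ mu)%N.
Proof.
move=> le_mu; case/and3P: lam_adm => _ /allP/(_ mu) + _.
by rewrite mem_iota add0n ltnS le_mu => /(_ isT)/and3P[].
Qed.

Lemma part_extE (mu i : nat) :
  part_ext e L lam mu i = nth 0%N (part0 mu :: partition_at lam mu) i.
Proof. by case: i. Qed.

Lemma part_term_level (mu : nat) : (mu <= n)%N ->
  part_term (w_ mu) (part0 mu) (partition_at lam mu)
  = q ^+ (\sum_(1 <= i < (e mu).+1) part lam mu i ^ 2) *
    \prod_(1 <= i < (e mu).+1)
      qbin (family_top e L lam mu i) (family_bot e L lam mu i).
Proof.
move=> le_mu; rewrite part_termE; last exact: admissible_wt_le_w.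
rewrite (size_partition_at shape_lam) // !big_add1 /=; congr (_ * _).
apply: eq_bigr => i _.
by rewrite /family_top /family_bot /= !part_extE big_add1.
Qed.

(** For [mu < n] the partition is non-empty and its last part is [w_ mu.+1] whatever the default
    [M]; for [mu = n] nothing remains and both sides are 1. *)
Lemma fam_term_next (mu M : nat) : (mu <= n)%N ->
  fam_term (last M (partition_at lam mu)) (w_ mu - partition_wt lam mu)
           (drop mu.+1 lam)
  = fam_term (w_ mu.+1) (part0 mu.+1) (drop mu.+1 lam).
Proof.
rewrite leq_eqVlt => /predU1P[->|lt_mu].
  by rewrite drop_oversize // (size_lam shape_lam).
by rewrite (w_S _ n_e_gt0 shape_lam M).
Qed.

Lemma fam_term_from (k mu : nat) : (mu + k = n.+1)%N ->
  fam_term (w_ mu) (part0 mu) (drop mu lam)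
  = q ^+ (\sum_(mu <= nu < n.+1) \sum_(1 <= i < (e nu).+1) part lam nu i ^ 2) *
    \prod_(mu <= nu < n.+1) \prod_(1 <= i < (e nu).+1)
      qbin (family_top e L lam nu i) (family_bot e L lam nu i).
Proof.
elim: k mu => [|k IHk] mu en.
  rewrite drop_oversize ?(size_lam shape_lam) // ?big_geq ?expr0 ?mulr1 //; lia.
have lt_mu : (mu < n.+1)%N by lia.
rewrite (drop_lam shape_lam) // [LHS]/= fam_term_next // part_term_level //.
rewrite IHk ?addSnnS // [in RHS]big_ltn // [X in _ = _ * X]big_ltn //.
by rewrite exprD mulrACA.
Qed.

Lemma top_termE :
  top_term L./2 lam
  = q ^+ (family_exponent n e lam) *
    \prod_(0 <= mu < n.+1) \prod_(1 + (mu == 0)%N <= i < (e mu).+1)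
      qbin (family_top e L lam mu i) (family_bot e L lam mu i).
Proof.
have rest := @fam_term_from n 1 (add1n n).
have := fam_term_next 0 (leq0n n); have := admissible_wt_le_w (leq0n n).
have elam : lam = partition_at lam 0 :: drop 1 lam.
  by rewrite -(drop_lam shape_lam) ?drop0.
rewrite /family_exponent big_ltn // [X in _ * X]big_ltn //.
have -> : \prod_(1 <= mu < n.+1) \prod_(1 + (mu == 0)%N <= i < (e mu).+1)
      qbin (family_top e L lam mu i) (family_bot e L lam mu i)
    = \prod_(1 <= mu < n.+1) \prod_(1 <= i < (e mu).+1)
      qbin (family_top e L lam mu i) (family_bot e L lam mu i).
  by apply: eq_big_nat => -[].
rewrite exprD mulrACA -rest {rest}.
have := size_partition_at shape_lam (leq0n n).
have part1 i : part lam 0 i.+1 = nth 0%N (partition_at lam 0) i by [].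
have ext1 i : part_ext e L lam 0 i.+1 = nth 0%N (partition_at lam 0) i by [].
have wt0 : partition_wt lam 0 = sumn (partition_at lam 0) by [].
rewrite !big_add1 [(e 0).+1.-1]/= wt0.
move: elam part1 ext1; case: (partition_at lam 0) => [|x t] elam part1 ext1 sz_t.
  by move: e0_gt0; rewrite -sz_t.
move=> le_w <-; rewrite [X in top_term _ X]elam top_term_cons // -sz_t /=; congr (q ^+ _ * _ * _).
  by apply: eq_bigr => i _; rewrite part1.
apply: eq_bigr => i _; rewrite /family_top /family_bot !ext1 big_add1.
by congr (qbin (2 * (_ - _) + _ + _) _); apply: eq_bigr => j _; rewrite part1.
Qed.

End AdmissibleTerm.

(** * Path generating functions and their recursion in the last step *)

Section PathSum.

Variables (p p' a : nat).

Local Notation paths := (paths p' a).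
Local Notation turn_wt := (turn_wt p p' a).

Definition path_sum (L b c : nat) : F :=
  \sum_(s <- paths L b) q ^+ path_wt p p' a c L s.

Lemma path_sum0 (b c : nat) :
  path_sum 0 b c = ((0 < b < p')%N && (b == a))%:R.
Proof.
rewrite /path_sum /=; case: ifP => // _; last by rewrite big_nil.
case: ifP => _; last by rewrite big_nil.
by rewrite big_seq1 /path_wt big_geq.
Qed.

Lemma path_sumS (L b c : nat) : (0 < b < p')%N ->
  path_sum L.+1 b c = q ^+ turn_wt L.+1 b.-1 b c * path_sum L b.-1 b
                      + q ^+ turn_wt L.+1 b.+1 b c * path_sum L b.+1 b.
Proof.
move=> lt_b; rewrite /path_sum pathsS lt_b big_map big_cat /= !mulr_sumr.
congr (_ + _); rewrite big_seq [RHS]big_seq; apply: eq_bigr => s.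
  by rewrite mem_paths => /path_wt_rcons->; rewrite exprD mulrC.
by rewrite mem_paths => /path_wt_rcons->; rewrite exprD mulrC.
Qed.

Lemma path_sum_out (L b c : nat) :
  ~~ (0 < b < p')%N -> path_sum L b c = 0.
Proof.
by move=> /negbTE out; rewrite /path_sum; case: L => [|L] /=; rewrite out big_nil.
Qed.

Lemma path_sum_unreachable (L b c : nat) :
  (a + L < b)%N || (b + L < a)%N -> path_sum L b c = 0.
Proof. by move=> far; rewrite /path_sum paths_unreachable // big_nil. Qed.

End PathSum.

(** * Gaussian polynomials and the Burge transform *)

Hypothesis q_neq0 : q != 0.
Hypothesis q_not_root : forall i : nat, (0 < i)%N -> 1 - q ^+ i != 0.

Lemma qp_neq0 (m : nat) : qp m != 0.
Proof.
rewrite /qp big_nat; elim/big_ind: _ => [|x y x0 y0|i /andP[/q_not_root //]].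
  exact: oner_neq0.
by rewrite mulf_neq0.
Qed.

Lemma qpS (m : nat) : qp m.+1 = qp m * (1 - q ^+ m.+1).
Proof. by rewrite /qp big_nat_recr. Qed.

Lemma qp0 : qp 0 = 1.
Proof. by rewrite /qp big_geq. Qed.

Lemma qbin_small (A B : nat) : (A < B)%N -> qbin A B = 0.
Proof. by move=> ltAB; rewrite /qbin leqNgt ltAB. Qed.

Lemma qbin0 (A : nat) : qbin A 0 = 1.
Proof. by rewrite /qbin /= subn0 qp0 mul1r divff ?qp_neq0. Qed.

Lemma qbinnn (A : nat) : qbin A A = 1.
Proof. by rewrite /qbin leqnn subnn qp0 mulr1 divff ?qp_neq0. Qed.

Lemma qbin_sub (A B : nat) : (B <= A)%N -> qbin A (A - B) = qbin A B.
Proof. by move=> leBA; rewrite /qbin leBA leq_subr subKn // [qp B * _]mulrC. Qed.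

Lemma qbinE (B D : nat) : qbin (B + D) B = qp (B + D) / (qp B * qp D).
Proof. by rewrite /qbin leq_addr addKn. Qed.

Lemma qbin_pascal (A B : nat) : qbin A.+1 B.+1 = qbin A B + q ^+ B.+1 * qbin A B.+1.
Proof.
have [ltAB|ltBA|->] := ltngtP A B; last by rewrite !qbinnn qbin_small ?mulr0 ?addr0.
  by rewrite !qbin_small ?mulr0 ?addr0 //; lia.
have {ltBA}-> : A = (B + (A - B.+1)).+1 by lia.
set D := (A - _)%N.
have -> : qbin (B + D).+2 B.+1 = qp (B + D).+2 / (qp B.+1 * qp D.+1).
  by rewrite -addSn -addnS qbinE.
have -> : qbin (B + D).+1 B = qp (B + D).+1 / (qp B * qp D.+1).
  by rewrite -addnS qbinE.
rewrite -addSn qbinE addSn !qpS.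
have h1 := qp_neq0 B; have h2 := qp_neq0 D; have h3 := qp_neq0 (B + D).
have := @q_not_root D.+1 isT; have := @q_not_root B.+1 isT.
have -> : q ^+ (B + D).+2 = q ^+ B.+1 * q ^+ D.+1 by rewrite -exprD addSn addnS.
move: (q ^+ B.+1) (q ^+ D.+1) => x y h4 h5.
by field; rewrite h1 h2 h4 h5.
Qed.

Lemma qbin_pascal' (A B : nat) :
  qbin A.+1 B.+1 = q ^+ (A - B) * qbin A B + qbin A B.+1.
Proof.
have [ltAB|ltBA|->] := ltngtP A B.
- by rewrite !qbin_small ?mulr0 ?addr0 //; lia.
- rewrite -qbin_sub; last by lia.
  rewrite subSS -[(A - B)%N]prednK; last by lia.
  rewrite qbin_pascal prednK; last by lia.
  rewrite -[in qbin A (A - B)%N]qbin_sub; last by lia.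
  have -> : (A - B).-1 = (A - B.+1)%N by lia.
  by rewrite qbin_sub // addrC subKn; last by lia.
- by rewrite subnn expr0 mul1r !qbinnn qbin_small ?addr0.
Qed.

(** Both products are the q-multinomial coefficient with parts [b], [a - b], [N - a]. *)
Lemma qbin_trinomial (N a b : nat) : (b <= a)%N ->
  qbin N a * qbin a b = qbin N b * qbin (N - b) (a - b).
Proof.
move=> le_ba; have [le_aN|lt_Na] := leqP a N; last first.
  rewrite qbin_small // mul0r; have [le_bN|lt_Nb] := leqP b N.
    by rewrite [qbin (N - b) _]qbin_small ?mulr0 //; lia.
  by rewrite qbin_small ?mul0r.
have -> : N = (b + ((a - b) + (N - a)))%N by lia.
set d := (N - a)%N; have -> : a = (b + (a - b))%N by lia.
set c := (a - b)%N.
have -> : (b + (b + c - b + d) = b + c + d)%N by lia.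
rewrite !qbinE.
have -> : (b + c + d = b + (c + d))%N by lia.
rewrite qbinE !addKn qbinE.
have := qp_neq0 b; have := qp_neq0 c; have := qp_neq0 d.
have := qp_neq0 (b + c); have := qp_neq0 (c + d).
by move=> h1 h2 h3 h4 h5; field; rewrite h1 h2 h3 h4 h5.
Qed.

Lemma qbin_vandermonde (X Y m : nat) :
  \sum_(0 <= j < m.+1) q ^+ ((m - j) * (X - j)) * qbin X j * qbin Y (m - j)
  = qbin (X + Y) m.
Proof.
elim: Y m => [|Y IHY] m.
  rewrite big_nat_recr //= subnn qbin0 mul0n expr0 mul1r mulr1 addn0.
  rewrite big_nat big1 ?add0r // => j /andP[_ lt_jm].
  by rewrite [qbin 0 _]qbin_small ?mulr0 // subn_gt0.
case: m => [|m]; first by rewrite big_nat1 !qbin0 mul0n expr0 !mulr1.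
rewrite addnS qbin_pascal' -(IHY m) -(IHY m.+1).
rewrite big_nat_recr //= [X in _ = _ + X]big_nat_recr //= subnn !qbin0 addrA.
congr (_ + _); rewrite mulr_sumr -big_split /=.
apply: eq_big_nat => j /andP[_ lt_jm].
rewrite subSn // qbin_pascal' mulrDr; congr (_ + _).
have [le_mY|lt_Ym] := leqP (m - j) Y; last by rewrite [qbin Y _]qbin_small ?mulr0 ?mul0r ?mulr0.
have [le_jX|lt_Xj] := leqP j X; last by rewrite [qbin X _]qbin_small ?mulr0 ?mul0r ?mulr0.
have -> : (X + Y - m = (X - j) + (Y - (m - j)))%N by lia.
by rewrite mulSn !exprD; ring.
Qed.

(** Induction on [K] with [d] free, since Pascal raises [d]. The range [m] is independent of [K] so
    that the identity applies inside a sum over [K]. *)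
Lemma qbin_vandermonde_shift (A K d m : nat) : (K <= m)%N ->
  \sum_(0 <= k < m.+1) q ^+ (k * (k + d)) * qbin K k * qbin A (k + d)
  = qbin (A + K) (K + d).
Proof.
elim: K d m => [|K IHK] d m.
  rewrite big_nat_recl //= qbin0 expr0 !mul1r addn0 big1 ?addr0 // => k _.
  by rewrite [qbin 0 _]qbin_small // mulr0 mul0r.
case: m => // m le_Km; rewrite addnS addSn qbin_pascal.
rewrite -(IHK d m.+1) ?leqW // -addnS -(IHK d.+1 m) //.
rewrite big_nat_recl //= [X in _ = X + _]big_nat_recl //= !qbin0 -addrA.
congr (_ + _); rewrite mulr_sumr -big_split /=; apply: eq_big_nat => k _.
rewrite qbin_pascal' mulrDr mulrDl addrC; congr (_ + _).
have [le_kK|lt_Kk] := leqP k K; last by rewrite [qbin K _]qbin_small ?mulr0 ?mul0r ?mulr0.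
rewrite addnS -addSnnS !mulrA -!exprD; congr (q ^+ _ * _ * _); lia.
Qed.

(* A form of the q-Pfaff-Saalschuetz summation: expand the first factor by
   Vandermonde, sum over [k], and recombine by Vandermonde. *)
Lemma qbin_saalschuetz (A C m d : nat) :
  \sum_(0 <= k < m.+1) q ^+ (k * (k + d)) * qbin (A + C + m - k) (m - k)
                       * qbin A (k + d) * qbin C k
  = qbin (A + m) (m + d) * qbin (C + m + d) m.
Proof.
transitivity (\sum_(0 <= k < m.+1) \sum_(0 <= K < m.+1)
  (q ^+ ((m - K) * (C - K)) * qbin C K * qbin (A + m) (m - K)) *
  (q ^+ (k * (k + d)) * qbin K k * qbin A (k + d))).
  apply: eq_big_nat => k /andP[_ lt_km].
  rewrite (@big_cat_nat _ _ _ k) //=; last exact: ltnW.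
  rewrite big_nat big1 ?add0r; last first.
    by move=> K /andP[_ lt_Kk]; rewrite [qbin K k]qbin_small // mulr0 mul0r mulr0.
  have [le_kC|lt_Ck] := leqP k C; last first.
    rewrite [qbin C k]qbin_small // mulr0 big_nat big1 // => K /andP[le_kK _].
    by rewrite [qbin C K]qbin_small ?mulr0 ?mul0r // (leq_trans lt_Ck).
  have -> : (A + C + m - k = (C - k) + (A + m))%N by lia.
  rewrite -qbin_vandermonde mulr_sumr 2!mulr_suml.
  rewrite -[X in index_iota X m.+1]add0n big_addn subSn; last exact: ltnSE.
  apply: eq_big_nat => j /andP[_ lt_j].
  (* With [K = j + k], this moves the dependence on [C] from [k] to [K], so that the inner sum over
     [k] can be evaluated. *)
  have := @qbin_trinomial C (j + k) k (leq_addl _ _); rewrite addnK => E.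
  have -> : (m - (j + k) = m - k - j)%N by lia.
  have -> : (C - (j + k) = C - k - j)%N by lia.
  set a := q ^+ _; set b := q ^+ _.
  transitivity (a * b * qbin (A + m) (m - k - j) * qbin A (k + d) * (qbin C (j + k) * qbin (j + k) k)).
    by rewrite E; ring.
  by ring.
rewrite exchange_big /=.
rewrite -addnA -(qbin_vandermonde C (m + d) m) mulr_sumr; apply: eq_big_nat => K /andP[_ lt_Km].
rewrite -mulr_sumr qbin_vandermonde_shift //.
have := @qbin_trinomial (A + m) (m + d) (m - K).
have -> : (A + m - (m - K) = A + K)%N by lia.
have -> : (m + d - (m - K) = K + d)%N by lia.
move=> E; rewrite -mulrA -E; last by lia.
by ring.
Qed.

(** * Gaussian polynomials at integer arguments and the transform of their pairs *)

Definition qbinz (A B : int) : F :=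
  match A, B with Posz A', Posz B' => qbin A' B' | _, _ => 0 end.

(* As [M] tends to infinity, [(1 - q) ... (1 - q^(2 L))] times this tends to
   [qbinz (2 L) (L - b)]; hence the two versions [burge_step] and [burge_first]
   of the transform. *)
Definition qbin_pair (L M : nat) (a b : int) : F :=
  qbinz (M%:Z + L%:Z + a - b) (M%:Z + a) * qbinz (M%:Z + L%:Z - a + b) (M%:Z - a).

Lemma qbinz_out (A B : int) : (B < 0) || (A < B) -> qbinz A B = 0.
Proof. by case: A B => [A|A] [B|B] //= ltAB; rewrite qbin_small. Qed.

Lemma qbinz_sub (A B : int) : qbinz A (A - B) = qbinz A B.
Proof.
have [outB|inB] := boolP ((B < 0) || (A < B)).
  by rewrite [RHS]qbinz_out // qbinz_out //; lia.
have [B' eB] : exists B' : nat, B = B' by exists `|B|%N; lia.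
have [A' eA] : exists A' : nat, A = A' by exists `|A|%N; lia.
subst A B; have le_BA : (B' <= A')%N by lia.
by rewrite subzn //= qbin_sub.
Qed.

(** The upper argument is natural because the rule fails one step lower: [qbinz 0 0] is 1, while
    [qbinz] vanishes at upper argument -1. *)
Lemma qbinz_pascal (n : nat) (B : int) :
  qbinz n.+1 B = qbinz n (B - 1) + q ^ B * qbinz n B.
Proof.
case: B => [[|B]|B].
- by rewrite [qbinz _ (0 - 1)]qbinz_out ?add0r // expr0z mul1r /= !qbin0.
- by rewrite (_ : Posz B.+1 - 1 = B); [exact: qbin_pascal | lia].
- by rewrite !qbinz_out ?mulr0 ?addr0 //; lia.
Qed.

Lemma qbinz_pascal' (n : nat) (B : int) :
  qbinz n.+1 B = q ^ (n.+1%:Z - B) * qbinz n (B - 1) + qbinz n B.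
Proof.
rewrite -qbinz_sub qbinz_pascal addrC.
have -> : n.+1%:Z - B - 1 = n%:Z - B by lia.
have -> : n.+1%:Z - B = n%:Z - (B - 1) by lia.
by rewrite !qbinz_sub.
Qed.

Lemma qbin_pair_opp (L M : nat) (a b : int) : qbin_pair L M (- a) (- b) = qbin_pair L M a b.
Proof. by rewrite /qbin_pair !opprK mulrC. Qed.

Lemma qbin_pair_swap (L M : nat) (a b : int) : qbin_pair L M a b = qbin_pair M L b a.
Proof.
rewrite /qbin_pair -[qbinz _ (M%:Z + a)]qbinz_sub -[qbinz _ (M%:Z - a)]qbinz_sub mulrC.
by congr (qbinz _ _ * qbinz _ _); lia.
Qed.

Lemma qbin_pair_out (L M : nat) (a b : int) :
  (M%:Z < `|a|) || (L%:Z < `|b|) -> qbin_pair L M a b = 0.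
Proof.
move=> out; rewrite /qbin_pair.
have [o1|i1] := boolP ((M%:Z + a < 0) || (M%:Z + L%:Z + a - b < M%:Z + a)).
  by rewrite qbinz_out ?mul0r.
by rewrite [X in _ * X]qbinz_out ?mulr0 //; lia.
Qed.

(** Terms with [i < a] vanish, so [i = k + a]; for [i > L] a Gaussian factor vanishes, so the
    cut-off disappears. The free factor [f] lets both versions of the transform use it. *)
Lemma burge_reindex (a b A C L M : nat) (f : nat -> F) :
  (L + a = A + b)%N -> (L + b = C + a)%N -> (a <= M)%N ->
  \sum_(0 <= i < M.+1 | (i <= L)%N) q ^+ (i ^ 2) * f i * qbin_pair (L - i) i a b
  = q ^+ (a ^ 2) * \sum_(0 <= k < (M - a).+1)
      q ^+ (k * (k + 2 * a)) * f (k + a)%N * qbin A (k + 2 * a) * qbin C k.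
Proof.
move=> eA eC le_aM; rewrite big_mkcond /= (@big_cat_nat _ _ _ a) //=; last first.
  exact: leqW.
rewrite big_nat big1 ?add0r => [|i /andP[_ lt_ia]]; last first.
  by case: ifP => // _; rewrite qbin_pair_out ?mulr0 //; lia.
rewrite -[X in index_iota X M.+1]add0n big_addn subSn // mulr_sumr.
apply: eq_big_nat => k _; rewrite !mulrA -exprD.
have -> : (a ^ 2 + k * (k + 2 * a) = (k + a) ^ 2)%N by lia.
case: leqP => [le_L|lt_L]; last first.
  have [lt_A|le_A] := ltnP A (k + 2 * a).
    by rewrite [qbin A _]qbin_small // mulr0 mul0r.
  by rewrite [qbin C _]qbin_small ?mulr0 //; lia.
rewrite -!mulrA; congr (_ * (_ * _)).
rewrite /qbin_pair; congr (_ * _).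
  have -> : (k + a)%N%:Z + (L - (k + a))%N%:Z + a%:Z - b%:Z = A%:Z by lia.
  by have -> : (k + a)%N%:Z + a%:Z = (k + 2 * a)%N%:Z by lia.
have -> : (k + a)%N%:Z + (L - (k + a))%N%:Z - a%:Z + b%:Z = C%:Z by lia.
by have -> : (k + a)%N%:Z - a%:Z = k%:Z by lia.
Qed.

Definition same_sign (a b : int) : Prop :=
  (0 <= a /\ 0 <= b) \/ (a <= 0 /\ b <= 0).

Lemma same_sign_ind (P : int -> int -> Prop) :
  (forall a b, P a b -> P (- a) (- b)) -> (forall a b : nat, P a b) ->
  forall a b, same_sign a b -> P a b.
Proof.
move=> PN Pnat a b [[a0 b0]|[a0 b0]].
  by have := Pnat `|a|%N `|b|%N; rewrite !gez0_abs.
rewrite -[a]opprK -[b]opprK; apply: PN.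
by have := Pnat `|a|%N `|b|%N; rewrite !lez0_abs.
Qed.

Lemma exp_square (a : nat) : q ^+ (a ^ 2) = q ^ (a%:Z * a%:Z).
Proof. by rewrite -mulnn -PoszM. Qed.

(** For natural [a], [b] this is q-Saalschuetz with [m = M - a] and [d = 2 * a]; if [M < a] or [a]
    and [b] differ by more than [L], both sides are 0. *)
Lemma burge_step (L M : nat) (a b : int) : same_sign a b ->
  burge_op (fun L' M' => qbin_pair L' M' a b) L M
  = q ^ (a * a) * qbin_pair L M a (a + b).
Proof.
move: a b; apply: same_sign_ind => [a b E|a b].
  rewrite -opprD qbin_pair_opp mulrNN -E; apply: eq_bigr => i _.
  by rewrite qbin_pair_opp.
have [lt_Ma|le_aM] := ltnP M a.
  rewrite qbin_pair_out ?mulr0; last by lia.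
  rewrite /burge_op big_nat_cond big1 //  => i /andP[lt_iM _]; rewrite qbin_pair_out ?mulr0 //; lia.
have [far|near_] := boolP ((L + a < b)%N || (L + b < a)%N).
  rewrite qbin_pair_out ?mulr0; last by lia.
  rewrite /burge_op big1 // => i le_iL; rewrite /qbin_pair.
  have [lt1|lt2] := orP far; first by rewrite qbinz_out ?mul0r ?mulr0 //; lia.
  by rewrite [X in _ * (_ * X)]qbinz_out ?mulr0 //; lia.
rewrite /burge_op (@burge_reindex a b (L + a - b) (L + b - a)) //; try lia.
set A := (L + a - b)%N; set C := (L + b - a)%N.
have := qbin_saalschuetz A C (M - a) (2 * a) => E.
transitivity (q ^+ (a ^ 2) * (qbin (A + (M - a)) (M - a + 2 * a) *
                qbin (C + (M - a) + 2 * a) (M - a))).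
  rewrite -E; congr (_ * _); apply: eq_big_nat => k /andP[_ lt_k].
  congr (_ * qbin _ _ * _ * _); rewrite /A /C; lia.
rewrite -exp_square; congr (_ * _).
rewrite /qbin_pair; congr (_ * _).
  have -> : M%:Z + L%:Z + a%:Z - (a%:Z + b%:Z) = (A + (M - a))%N%:Z.
    by lia.
  by have -> : M%:Z + a%:Z = (M - a + 2 * a)%N%:Z by lia.
have -> : M%:Z + L%:Z - a%:Z + (a%:Z + b%:Z) = (C + (M - a) + 2 * a)%N%:Z by lia.
by have -> : M%:Z - a%:Z = (M - a)%N%:Z by lia.
Qed.

(** Without the Gaussian factor of [burge_op], Vandermonde takes the place of q-Saalschuetz. *)
Lemma burge_first (L : nat) (a b : int) : same_sign a b ->
  \sum_(0 <= i < L.+1) q ^+ (i ^ 2) * qbin_pair (L - i) i a b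
  = q ^ (a * a) * qbinz (2 * L)%N (L%:Z - (a + b)).
Proof.
move: a b; apply: same_sign_ind => [a b E|a b].
  rewrite mulrNN -qbinz_sub -opprD -(_ : L%:Z - (a + b) = (2 * L)%N%:Z - (L%:Z - - (a + b))).
    by rewrite -E; apply: eq_bigr => i _; rewrite qbin_pair_opp.
  by lia.
have [lt_La|le_aL] := ltnP L (a + b).
  rewrite qbinz_out ?mulr0; last by lia.
  rewrite big_nat big1 // => i /andP[_ lt_iL]; rewrite qbin_pair_out ?mulr0 //; lia.
have -> : \sum_(0 <= i < L.+1) q ^+ (i ^ 2) * qbin_pair (L - i) i a b
  = \sum_(0 <= i < L.+1 | (i <= L)%N) q ^+ (i ^ 2) * 1 * qbin_pair (L - i) i a b.
  rewrite [RHS]big_nat_cond [LHS]big_nat; apply: eq_big => [i|i _]; first by lia.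
  by rewrite mulr1.
rewrite (@burge_reindex a b (L + a - b) (L + b - a) L L (fun=> 1)) //; try lia.
set A := (L + a - b)%N; set C := (L + b - a)%N.
rewrite -exp_square; congr (_ * _).
transitivity (qbin (A + C) (C + 2 * a)); last first.
  rewrite -qbinz_sub -[qbin _ _]/(qbinz (A + C)%N (C + 2 * a)%N); congr (qbinz _ _); lia.
rewrite -(qbin_vandermonde_shift A (2 * a) (leq_addl (L - a) C)).
rewrite [RHS](@big_cat_nat _ _ _ (L - a).+1) //=; last by rewrite ltnS leq_addr.
rewrite [X in _ = _ + X]big_nat [X in _ = _ + X]big1 ?addr0; last first.
  by move=> k /andP[lt_k _]; rewrite [qbin A _]qbin_small ?mulr0 //; lia.
by apply: eq_bigr => k _; rewrite mulr1 mulrAC.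
Qed.

Arguments qbinz : simpl never.

(** * Bosonic sums along the continued fraction *)

Definition dbl_bosonic (N : nat) (p p' r s : int) (L M : nat) : F :=
  zsum N (fun l =>
    q ^ (l * l * p * p' + l * (p' * r - p * s)) * qbin_pair L M (p * l) (p' * l)
    - q ^ ((l * p + r) * (l * p' + s)) * qbin_pair L M (l * p + r) (l * p' + s)).

(** Termwise [burge_step]: the factor [q ^ (a * a)] and the shift of [b] by [a] produce the new
    exponents. The bounds on [r] and [s] give the two indices the same sign for every [l]. *)
Lemma dbl_bosonic_burge (N : nat) (p p' r s : int) (L M : nat) :
  0 <= r <= p -> 0 <= s <= p' ->
  dbl_bosonic N p (p' + p) r (s + r) L M = burge_op (dbl_bosonic N p p' r s) L M.
Proof.
move=> /andP[r0 rp] /andP[s0 sp].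
rewrite /burge_op; under eq_bigr => i _ do rewrite mulr_sumr.
rewrite exchange_big; apply: eq_bigr => j _ /=; set l : int := j%:Z - N%:Z.
under eq_bigr => i _ do rewrite mulrBr ![_ * (q ^ _ * _)]mulrCA.
rewrite sumrB -!mulr_sumr.
have S1 : same_sign (p * l) (p' * l).
  by rewrite /same_sign; have [l0|l0] := lerP 0 l; [left|right]; nia.
have S2 : same_sign (l * p + r) (l * p' + s).
  by rewrite /same_sign; have [l0|l0] := lerP 0 l; [left|right]; nia.
have := burge_step L M S1; rewrite /burge_op => ->.
have := burge_step L M S2; rewrite /burge_op => ->.
rewrite !mulrA -!expfzDr //.
by congr (q ^ _ * qbinz _ _ * qbinz _ _ - q ^ _ * qbinz _ _ * qbinz _ _); ring.
Qed.

Lemma dbl_bosonic_swap (N : nat) (p p' r s : int) (L M : nat) :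
  dbl_bosonic N p p' r s L M = dbl_bosonic N p' p s r M L.
Proof.
rewrite /dbl_bosonic !zsumB; congr (_ - _).
  (* The exchange flips the sign of the linear exponent, which [l -> - l] repairs. *)
  rewrite zsum_opp; apply: eq_zsum => l.
  by rewrite !mulrN qbin_pair_opp qbin_pair_swap; congr (q ^ _ * _); ring.
by apply: eq_zsum => l; rewrite qbin_pair_swap mulrC [in q ^ _]mulrC mulrC.
Qed.

Lemma dbl_bosonic_first (N : nat) (p p' r s : int) (w : nat) :
  0 <= r <= p -> 0 <= s <= p' ->
  \sum_(0 <= i < w.+1) q ^+ (i ^ 2) * dbl_bosonic N p p' r s (w - i) i
  = zsum N (fun l =>
      q ^ (l * l * p * (p' + p) + l * ((p' + p) * r - p * (s + r)))
        * qbinz (2 * w)%N (w%:Z - (p' + p) * l)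
      - q ^ ((l * p + r) * (l * (p' + p) + (s + r)))
        * qbinz (2 * w)%N (w%:Z - (l * (p' + p) + (s + r)))).
Proof.
move=> /andP[r0 rp] /andP[s0 sp].
under eq_bigr => i _ do rewrite mulr_sumr.
rewrite exchange_big; apply: eq_bigr => j _ /=; set l : int := j%:Z - N%:Z.
under eq_bigr => i _ do rewrite mulrBr ![_ * (q ^ _ * _)]mulrCA.
rewrite sumrB -!mulr_sumr.
have S1 : same_sign (p * l) (p' * l).
  by rewrite /same_sign; have [l0|l0] := lerP 0 l; [left|right]; nia.
have S2 : same_sign (l * p + r) (l * p' + s).
  by rewrite /same_sign; have [l0|l0] := lerP 0 l; [left|right]; nia.
rewrite !burge_first // !mulrA -!expfzDr //.
by congr (q ^ _ * qbinz _ _ - q ^ _ * qbinz _ _); ring.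
Qed.

Lemma dbl_bosonic_11 (N L M : nat) : (L + M < N)%N ->
  dbl_bosonic N 1 1 0 1 L M = ((L == 0%N) && (M == 0%N))%:R.
Proof.
move=> ltN; have [n0|n_gt0] := posnP (L + M).
  have [-> ->] : L = 0%N /\ M = 0%N by lia.
  rewrite /dbl_bosonic zsum_single => [|l l0].
    rewrite !(mul0r, mulr0, add0r, expr0z, mul1r, mulr1).
    rewrite [X in _ - X]qbin_pair_out // subr0.
    by rewrite -[LHS]/(qbin 0 0 * qbin 0 0) !qbin0 // mulr1.
  by rewrite !qbin_pair_out ?mulr0 ?subrr //; lia.
have -> : (L == 0%N) && (M == 0%N) = false by lia.
have [n En] : exists n, (L + M = n.+1)%N by exists (L + M).-1; lia.
pose f l := q ^ (l * l - l) * (qbinz n.+1 (M%:Z + l) * qbinz n.+1 (M%:Z - l)).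
pose g l := q ^ (l * l + l) * (qbinz n (M%:Z + l) * qbinz n.+2 (M%:Z - l)).
pose t l := q ^ (M%:Z + l * l) * (qbinz n (M%:Z + l) * qbinz n.+1 (M%:Z - l)).
(* Pascal on the first factor of [f l] and on the second of [g (l - 1)] yields a common term that
   cancels; the rest telescopes. *)
have fg l : f l - g (l - 1) = t l - t (l - 1).
  rewrite /f /g /t qbinz_pascal //.
  have -> : M%:Z - (l - 1) = M%:Z - l + 1 by lia.
  have -> : M%:Z + (l - 1) = M%:Z + l - 1 by lia.
  have -> : (l - 1) * (l - 1) + (l - 1) = l * l - l by ring.
  rewrite [qbinz n.+2 _]qbinz_pascal // addrK.
  have -> : M%:Z + l * l = (l * l - l) + (M%:Z + l) by ring.
  have -> : M%:Z + (l - 1) * (l - 1) = (l * l - l) + (M%:Z - l + 1) by ring.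
  by rewrite !expfzDr //; ring.
have -> : dbl_bosonic N 1 1 0 1 L M = zsum N f - zsum N g.
  rewrite -zsumB; apply: eq_zsum => l; rewrite /f /g /qbin_pair.
  congr (q ^ _ * (qbinz _ _ * qbinz _ _) - q ^ _ * (qbinz _ _ * qbinz _ _)); lia.
rewrite -(@zsum_shift _ N g); last 2 first.
- by rewrite /g [X in _ * (_ * X)]qbinz_out ?mulr0 //; lia.
- by rewrite /g [qbinz n _]qbinz_out ?mul0r ?mulr0 //; lia.
rewrite -zsumB (eq_zsum _ fg) zsum_telescope /t.
rewrite [X in _ * (_ * X) - _]qbinz_out; last by lia.
by rewrite [X in _ - _ * (X * _)]qbinz_out ?mul0r ?mulr0 ?subrr //; lia.
Qed.

(** A transform evaluates its function only at [(L - i, i)], of total size [L], so one truncation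
    [N] serves the whole chain. *)
Lemma burge_op_bounded (K : nat) (f g : nat -> nat -> F) :
  (forall L M, (L + M <= K)%N -> f L M = g L M) ->
  forall L M, (L + M <= K)%N -> burge_op f L M = burge_op g L M.
Proof.
move=> eqfg L M leK; apply: eq_bigr => i le_iL; rewrite eqfg // subnK //.
exact: leq_trans (leq_addr _ _) leK.
Qed.

Lemma iter_burge_op_bounded (K k : nat) (f g : nat -> nat -> F) :
  (forall L M, (L + M <= K)%N -> f L M = g L M) ->
  forall L M, (L + M <= K)%N -> iter k burge_op f L M = iter k burge_op g L M.
Proof. by move=> eqfg; elim: k => //= k IHk; apply: burge_op_bounded. Qed.

Lemma dbl_bosonic_burge_iter (N k : nat) (p p' r s : int) (L M : nat) :
  0 <= r <= p -> 0 <= s <= p' ->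
  dbl_bosonic N p (p' + k%:Z * p) r (s + k%:Z * r) L M = iter k burge_op (dbl_bosonic N p p' r s) L M.
Proof.
move=> rp sp'; elim: k L M => [|k IHk] L M; first by rewrite !mul0r !addr0.
have -> : p' + k.+1%:Z * p = (p' + k%:Z * p) + p by rewrite intS mulrDl mul1r; lia.
have -> : s + k.+1%:Z * r = (s + k%:Z * r) + r by rewrite intS mulrDl mul1r; lia.
rewrite dbl_bosonic_burge //=; last by nia.
by apply: burge_op_bounded (leqnn _) => L' M' _; apply: IHk.
Qed.

(** One transform leads back to [Y(1,1)], directly for [r = 0] and after an exchange for [r = 1].
    Its delta leaves only [i = 0] and [L = 0], with coefficient 1. *)
Lemma dbl_bosonic_12 (N L M : nat) (r : int) : (L + M < N)%N -> 0 <= r <= 1 ->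
  dbl_bosonic N 1 2 r 1 L M = (L == 0%N)%:R.
Proof.
move=> ltN r01.
have -> : dbl_bosonic N 1 2 r 1 L M = dbl_bosonic N 1 (1 + 1) r ((1 - r) + r) L M.
  by rewrite subrK.
rewrite dbl_bosonic_burge //; last by lia.
have E L' M' : (L' + M' < N)%N ->
    dbl_bosonic N 1 1 r (1 - r) L' M' = ((L' == 0%N) && (M' == 0%N))%:R.
  move=> ltN'; have [->|->] : r = 0 \/ r = 1 by lia.
    by rewrite subr0 dbl_bosonic_11.
  by rewrite subrr dbl_bosonic_swap dbl_bosonic_11 1?andbC // addnC.
rewrite /burge_op big_ltn_cond //= big_nat_cond big1 => [|i /andP[i_in le_iL]].
  rewrite addr0 !subn0 E; last by lia.
  rewrite andbT expr0 mul1r; case: eqP => [->|_]; last by rewrite mulr0.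
  by rewrite muln0 add0n qbinnn // mulr1.
rewrite E; last by lia.
by have /andP[/gtn_eqF-> _] := i_in; rewrite andbF mulr0.
Qed.

(** A quotient [c] undoes [c] transforms, replacing [p'] by [p' - c * p]; the exchange then inverts
    the fraction. The last quotient [e + 2] stops at [Y(1,2)] after [e] transforms. *)
Lemma dbl_bosonic_cfrac (es : seq nat) (e N : nat) (p p' r s : int) (L M : nat) :
  0 < p -> 0 < p' -> 0 <= r <= p -> 0 <= s <= p' -> `|p' * r - p * s| = 1 ->
  p'%:~R / p%:~R = cfrac_val (rcons es (e + 2)) -> (L + M < N)%N ->
  dbl_bosonic N p p' r s L M = burge_chain (rcons es e) L M.
Proof.
elim: es p p' r s L M => [|c es IHes] p p' r s L M p0 p'0 rp sp' det.
  move=> /= val_e ltN.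
  have pnz : (p%:~R : rat) != 0 by rewrite intr_eq0 gt_eqF.
  have p'E : p' = (e%:Z + 2) * p.
    apply: (@intr_inj rat); rewrite intrM -[LHS](divfK pnz) val_e.
    by rewrite pmulrn PoszD.
  have p1 : p = 1.
    (* As [p] divides [p'], it divides the determinant. *)
    have : p * `|(e%:Z + 2) * r - s| = 1.
      rewrite -[p in LHS]gtr0_norm // -normrM -[RHS]det p'E; congr `|_|; ring.
    move: (normr_ge0 ((e%:Z + 2) * r - s)); move: `|_| => x x0 px1.
    have x1 : 0 < x by rewrite lt0r x0 andbT; apply: contra_eqN px1 => /eqP->; rewrite mulr0.
    have : p * 1 <= p * x by rewrite ler_pM2l.
    by lia.
  subst p; rewrite mulr1 in p'E.
  have := @burge_bounds 1 p' r s e p0; rewrite mulr1 => /(_ _ det rp sp') bnd.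
  have {bnd} : 0 <= s - e%:Z * r <= p' - e%:Z by apply: bnd; lia.
  have -> : p' - e%:Z = 2 by lia.
  move=> bnd.
  have -> : p' = 2 + e%:Z * 1 by lia.
  rewrite -[s](subrK (e%:Z * r)) dbl_bosonic_burge_iter //.
  have -> : s - e%:Z * r = 1.
    (* The determinant makes [s - e * r] odd, and it lies between 0 and 2. *)
    have : `|2 * r - (s - e%:Z * r)| = 1 by rewrite -[RHS]det p'E; congr `|_|; ring.
    lia.
  apply: (@iter_burge_op_bounded (L + M)) => // L' M' le'; rewrite dbl_bosonic_12 //.
  exact: leq_ltn_trans le' ltN.
rewrite rcons_cons cfrac_val_cons => val_c ltN.
have v0 : 0 < cfrac_val (rcons es (e + 2)) by apply: cfrac_val_gt0; lia.
move: (cfrac_val _) v0 val_c IHes => v v0 val_c IHes.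
have pnz : (p%:~R : rat) != 0 by rewrite intr_eq0 gt_eqF.
have vE : (p' - c%:Z * p)%:~R = p%:~R / v :> rat.
  rewrite rmorphB rmorphM /= -[p'%:~R](divfK pnz) val_c mulrDl.
  by rewrite -pmulrn addrAC subrr add0r mulrC.
have p''0 : 0 < p' - c%:Z * p.
  by rewrite -(@ltr0z rat) vE divr_gt0 // ltr0z.
have bnd := burge_bounds p0 p''0 det rp sp'.
rewrite -[p'](subrK (c%:Z * p)) -[s](subrK (c%:Z * r)) dbl_bosonic_burge_iter //=.
apply: (@iter_burge_op_bounded (L + M)) => // L' M' le'; rewrite dbl_bosonic_swap.
apply: IHes => //.
- by rewrite -[RHS]det -normrN; congr `|_|; ring.
- by rewrite vE invfM invrK mulrA divff // mul1r.
- by rewrite addnC; apply: leq_ltn_trans le' ltN.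
Qed.

(** * The bosonic form of the path sums *)

Section BosonicForm.

Variable N : nat.

(* Here [d] is the number of down steps, [d = (L + a - b) / 2]; it may be
   negative when no path of length [L] reaches [b]. *)
Definition bosonic (p p' a r : int) (L : nat) (d : int) : F :=
  zsum N (fun l =>
    q ^ (l * l * p * p' + l * (p' * r - p * a)) * qbinz L (d - p' * l)
    - q ^ ((l * p + r) * (l * p' + a)) * qbinz L (d - (l * p' + a))).

Lemma pascal_regroup (x1 x2 y1 y2 z w1 w2 g1 g2 h1 h2 : F) :
  x1 * y1 = z * w1 -> x2 * y2 = z * w2 ->
  x1 * (h1 + y1 * g1) - x2 * (h2 + y2 * g2)
  = z * (w1 * g1 - w2 * g2) + (x1 * h1 - x2 * h2).
Proof. by move=> e1 e2; rewrite mulrBr !mulrDr !mulrA e1 e2; ring. Qed.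

(** The Pascal coefficient lowers [r] by one in both exponents and leaves [q ^ d], independent of
    [l]; this is why the recursion closes on the same sums. *)
Lemma bosonic_down (p p' a r : int) (L : nat) (d : int) :
  bosonic p p' a r L.+1 d = q ^ d * bosonic p p' a (r - 1) L d + bosonic p p' a r L (d - 1).
Proof.
rewrite /bosonic -zsumZ -zsumD; apply: eq_zsum => l; rewrite !qbinz_pascal //.
have -> : d - p' * l - 1 = d - 1 - p' * l by ring.
have -> : d - (l * p' + a) - 1 = d - 1 - (l * p' + a) by ring.
by apply: pascal_regroup; rewrite -!expfzDr //; congr (q ^ _); ring.
Qed.

Lemma bosonic_up (p p' a r : int) (L : nat) (d : int) :
  bosonic p p' a r L.+1 d
  = bosonic p p' a r L d + q ^ (L.+1%:Z - d) * bosonic p p' a (r + 1) L (d - 1).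
Proof.
rewrite /bosonic -zsumZ -zsumD; apply: eq_zsum => l.
rewrite !(qbinz_pascal') ![_ * _ + qbinz L _]addrC.
have -> : d - p' * l - 1 = d - 1 - p' * l by ring.
have -> : d - (l * p' + a) - 1 = d - 1 - (l * p' + a) by ring.
rewrite [RHS]addrC.
by apply: pascal_regroup; rewrite -!expfzDr //; congr (q ^ _); ring.
Qed.

(** The wall at height 0: reflection [l -> - l] matches the two halves. *)
Lemma bosonic_bottom (p p' a : int) (L : nat) (d : int) :
  a + L%:Z = d + d -> bosonic p p' a 0 L d = 0.
Proof.
move=> ed; rewrite /bosonic zsumB [X in _ - X]zsum_opp; apply/eqP.
rewrite subr_eq0; apply/eqP/eq_zsum => l; rewrite -[in RHS]qbinz_sub.
by congr (q ^ _ * qbinz _ _); [ring | lia].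
Qed.

(** The wall at height [p']: the reflection is combined with a shift of [l] by one, whose end terms
    vanish as [L < N]. *)
Lemma bosonic_top (p p' a : int) (L : nat) (d : int) :
  0 < a < p' -> (L < N)%N -> a + L%:Z = p' + (d + d) -> bosonic p p' a p L d = 0.
Proof.
move=> /andP[a0 ap'] ltLN ed; rewrite /bosonic zsumB [X in _ - X]zsum_opp.
pose f l := q ^ (l * l * p * p' + l * (p' * p - p * a)) * qbinz L (d - p' * l).
have le_N : N%:Z <= p' * N%:Z by nia.
rewrite -[X in X - _]/(zsum N f) -(@zsum_shift _ N f); last 2 first.
- by rewrite /f qbinz_out ?mulr0 //; lia.
- by rewrite /f qbinz_out ?mulr0 //; lia.
apply/eqP; rewrite subr_eq0; apply/eqP/eq_zsum => l; rewrite /f -[in RHS]qbinz_sub.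
by congr (q ^ _ * qbinz _ _); [ring | lia].
Qed.

Lemma bosonic_init (p p' a r d : int) :
  0 < a < p' -> 0 < a - (d + d) < p' -> bosonic p p' a r 0 d = (d == 0)%:R.
Proof.
move=> /andP[a0 ap'] /andP[b0 bp']; rewrite /bosonic zsum_single => [|l l0].
  rewrite [qbinz 0 (d - (_ + a))]qbinz_out; last by lia.
  rewrite !(mul0r, mulr0, add0r, subr0, expr0z, mul1r).
  have [->|d0] := eqVneq d 0; first by rewrite -[qbinz _ _]/(qbin 0 0) qbin0.
  by rewrite qbinz_out //; lia.
have big : p' <= `|p' * l|.
  by rewrite normrM gtr0_norm ?ler_peMr //; lia.
rewrite qbinz_out; last by lia.
rewrite [qbinz 0 (d - (l * _ + a))]qbinz_out ?mulr0 ?subrr //.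
have [lpos|lneg] : 0 < l \/ l < 0 by lia.
  have : 0 < l * p' by nia.
  by lia.
have : l * p' <= - p' by nia.
by lia.
Qed.

Lemma path_sum_bosonic (p p' a L b c : nat) (d : int) :
  (0 < p < p')%N -> (0 < a < p')%N -> (0 < b < p')%N -> (L < N)%N ->
  (c == b.+1) || (b == c.+1) -> a%:Z + L%:Z = b%:Z + (d + d) ->
  path_sum p p' a L b c
  = bosonic p p' a ((c * p) %/ p' + (c < b))%N L d.
Proof.
move=> pp' ap'; elim: L b c d => [|L IHL] b c d bp' ltN bc ed.
  rewrite path_sum0 bp' bosonic_init; [|lia|lia].
  by congr (nat_of_bool _)%:R; lia.
rewrite path_sumS //; set f := ((b * p) %/ p')%N.
have down : path_sum p p' a L b.-1 b = bosonic p p' a f L d.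
  have [b1|b1] := eqVneq b 1%N.
    rewrite path_sum_out; last by lia.
    have -> : f = 0%N by rewrite /f b1 mul1n divn_small //; lia.
    by rewrite bosonic_bottom //; lia.
  by rewrite (IHL _ _ d) /f ?ltnNge ?leq_pred ?addn0 //; lia.
have up : path_sum p p' a L b.+1 b = bosonic p p' a f.+1 L (d - 1).
  have [b1|b1] := eqVneq b.+1 p'.
    rewrite path_sum_out; last by lia.
    (* Below the upper wall [b * p] is [p' * (p - 1)] plus the remainder [p' - p]. *)
    have -> : f.+1 = p.
      rewrite /f -(_ : p' * p.-1 + (p' - p) = b * p)%N; last by nia.
      by rewrite mulnC divnMDl ?divn_small //; lia.
    by rewrite bosonic_top //; lia.
  by rewrite (IHL _ _ (d - 1)) ?ltnSn ?addn1 //; lia.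
(* Truncation matters only for negative [d], where no path exists and both sides are 0; likewise for
   [up_wt]. *)
have down_wt : q ^+ ((L.+1 + a - b)./2) * path_sum p p' a L b.-1 b
               = q ^ d * bosonic p p' a f L d.
  have [d0|d0] := ltrP d 0.
    by rewrite -down path_sum_unreachable ?mulr0 //; lia.
  by rewrite -down exprnP; congr (q ^ _ * _); lia.
have up_wt : q ^+ ((L.+1 + b - a)./2) * path_sum p p' a L b.+1 b
             = q ^ (L.+1%:Z - d) * bosonic p p' a f.+1 L (d - 1).
  have [d0|d0] := ltrP L.+1%:Z d.
    by rewrite -up path_sum_unreachable ?mulr0 //; lia.
  by rewrite -up exprnP; congr (q ^ _ * _); lia.
have floorS k : ((k.+1 * p) %/ p' = (k * p) %/ p' + odd_band p p' k)%N.
  rewrite /odd_band; have := divn_eq (k * p) p'; have := divn_eq (k.+1 * p) p'.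
  have := @ltn_pmod (k * p) p'; have := @ltn_pmod (k.+1 * p) p'.
  case: eqP => /= [->|]; first by rewrite addn0.
  by rewrite mulSn; nia.
(* Of the two arrivals at [b] one is straight and the other a peak, with the same band parity, so
   exactly one scores. The bit [s] records which, fixes [r = f + s], and selects the Pascal rule. *)
have [s [-> -> ->]] : exists s : bool,
  [/\ ((c * p) %/ p' + (c < b) = f + s)%N,
      turn_wt p p' a L.+1 b.-1 b c = if s then (L.+1 + a - b)./2 else 0%N &
      turn_wt p p' a L.+1 b.+1 b c = if s then 0%N else (L.+1 + b - a)./2].
  rewrite /turn_wt; have [/eqP c_up|c_down] := boolP (c == b.+1).
    exists (odd_band p p' b); rewrite c_up floorS ltnNge leqnSn addn0.
    rewrite (minn_idPl (leqnSn b)) eqxx.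
    have -> : b.-1 != b.+1 by lia.
    have -> : b == b.-1.+1 by lia.
    have -> : (b == b.+2) = false by lia.
    by split=> //; case: odd_band.
  have bE : b = c.+1 by lia.
  exists (~~ odd_band p p' c); rewrite /f bE floorS ltnSn.
  rewrite (minn_idPr (leqnSn c)) /= !eqxx.
  have -> : c.+2 != c by lia.
  have -> : (c.+1 == c.+3) = false by lia.
  by split; case: odd_band => //=; lia.
case: s; rewrite expr0 mul1r.
  by rewrite down_wt up addn1 bosonic_down; congr (_ * bosonic _ _ _ _ _ _ + _); lia.
by rewrite up_wt down addn0 bosonic_up; congr (_ + _ * bosonic _ _ _ _ _ _); lia.
Qed.

End BosonicForm.

End QSeries.

(** * Specialization to the field of rational functions and conclusion *)

Lemma q_neq0 : q_ != 0.
Proof. by rewrite tofrac_eq0 polyX_eq0. Qed.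

Lemma q_not_root (i : nat) : (0 < i)%N -> 1 - q_ ^+ i != 0.
Proof.
move=> i_gt0; rewrite -rmorphXn -tofrac1 -rmorphB tofrac_eq0.
apply: contraTneq i_gt0 => /(congr1 (fun f : {poly int} => f`_0)).
by rewrite coefB coef1 coefXn coef0 eq_sym; case: i.
Qed.

Lemma tofrac_chi (p p' a b c L : nat) :
  tofrac (chi p p' a b c L) = path_sum q_ p p' a L b c.
Proof.
rewrite rmorph_sum /path_sum.
rewrite -(@sum_tuple_seq p' L.+1 (is_path p' a b L)
           _ (fun s => q_ ^+ path_wt p p' a c L s)) ?paths_uniq //.
  by apply: eq_bigr => h _; rewrite rmorphXn.
move=> s; rewrite mem_paths; apply/idP/and3P => [pth|[] //].
split=> //; first by case/andP: pth.
by case/and3P: pth => _ /allP lt_s _; apply/allP => x /lt_s; lia.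
Qed.

Local Close Scope ring_scope.

Theorem theorem5p4 (p p' r0 s0 n L : nat) (e : nat -> nat)
  (hp : 0 < p) (hpp' : p < p') (hp' : 3 <= p') (hcop : coprime p p')
  (hrs : (`|(p * s0)%N%:Z - (p' * r0)%N%:Z| = 1 :> int)%R)
  (hmin : forall r s : nat,
     (`|(p * s)%N%:Z - (p' * r)%N%:Z| = 1 :> int)%R -> r0 <= r /\ s0 <= s)
  (hcf : has_cfrac (p'%:R / p%:R)%R (rcons (mkseq e n) (e n + 2)))
  (hL : ~~ odd L) :
  tofrac (chi p p' s0 s0 s0.+1 L)
  = (\sum_(lam <- families n e L) family_term n e L lam)%R.
Proof.
have [s0_in le_r0p floor_r0] := minimal_solution hp hpp' hp' hrs hmin.
have e_gt0 := cfrac_pos_head hp hpp' hp' hcop hcf.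
have e0_gt0 : (0 < e 0) by apply: e_gt0.
have n_e_gt0 mu : (mu < n) -> (0 < e mu).
  by move=> lt_mu; apply: e_gt0; rewrite lt_mu orbT.
have det : (`|p'%:Z * r0%:Z - p%:Z * s0%:Z| = 1)%R.
  by rewrite distrC -!PoszM.
have LE : L = (2 * L./2) by rewrite mul2n even_halfK.
set w := L./2 in LE *.
have bnd : (0 <= s0%:Z - r0%:Z <= p'%:Z - p%:Z)%R.
  have := @burge_bounds p p' r0 s0 1; rewrite !mul1r; apply=> //; lia.
rewrite tofrac_chi.
rewrite (@path_sum_bosonic _ _ q_neq0 q_not_root L.+1 p p' s0 L s0 s0.+1 w) //;
  try lia.
rewrite floor_r0 ltnNge leqnSn addn0.
(* The start and end heights agree, so there are [w] down steps; one application of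
   [dbl_bosonic_first] undoes the outermost transform. *)
have -> : bosonic q_ L.+1 p p' s0 r0 L w
  = (\sum_(0 <= i < w.+1) q_ ^+ (i ^ 2)
      * dbl_bosonic q_ L.+1 p (p'%:Z - p%:Z) r0 (s0%:Z - r0%:Z) (w - i) i)%R.
  rewrite (dbl_bosonic_first q_neq0 q_not_root) //; try lia.
  by rewrite !subrK /bosonic -LE.
have [es [x [esE valE]]] := cfrac_lower_head n e0_gt0.
have [_ _ _ val] := hcf.
have chain i : (i < w.+1) ->
  dbl_bosonic q_ L.+1 p (p'%:Z - p%:Z)%R r0 (s0%:Z - r0%:Z)%R (w - i) i
  = burge_chain q_ ((e 0).-1 :: [seq e i | i <- iota 1 n]) (w - i) i.
  have det' : (`|(p'%:Z - p%:Z) * r0%:Z - p%:Z * (s0%:Z - r0%:Z)| = 1)%R.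
    by rewrite -[RHS]det; congr (`|_|)%R; ring.
  move=> le_iw; rewrite -esE.
  apply: (dbl_bosonic_cfrac q_neq0 q_not_root _ _ _ bnd det'); try lia.
  by rewrite valE -val rmorphB mulrBl divff // intr_eq0; lia.
transitivity (\sum_(0 <= i < w.+1) q_ ^+ (i ^ 2)
   * burge_chain q_ ((e 0).-1 :: [seq e i | i <- iota 1 n]) (w - i) i)%R.
  by apply: eq_big_nat => i /andP[_ lt_iw]; rewrite chain.
(* The outer sum supplies the first part, restoring [e 0] from its predecessor. *)
rewrite top_family_list prednK // -[e 0 :: _]/(mkseq e n.+1).
rewrite (perm_big (families n e L)); last first.
  apply: uniq_perm; [exact: family_list_uniq | exact: families_uniq |] => lam.
  by rewrite mem_families mem_family_list.
rewrite big_seq [RHS]big_seq; apply: eq_bigr => lam.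
by rewrite mem_families => adm; rewrite (top_termE q_ n_e_gt0 e0_gt0 adm).
Qed.
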